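(* Let $d\ge 2$ and $\delta>0$. Consider $2$-neighbour bootstrap percolation on the torus $\mathbb{T}_n^d=(\mathbb{Z}/n\mathbb{Z})^d$, and let $\mathcal{C}_n$ be the event of complete occupation. There exist a sequence $\eta_n\ge 0$ with $\eta_n\to 0$ as $n\to\infty$ and an integer $n_0$, both depending only on $d$ and $\delta$, such that for every $n\ge n_0$, every $p(n)\in(0,1)$ with $\mathbb{P}_{p(n)}(\mathcal{C}_n)\in(\delta,1-\delta)$, and every vertex $x\in\mathbb{T}_n^d$, $$\frac{(\log n)^{d-\eta_n}}{n^d}\;\le\;\mathbb{P}_{p(n)}\big(x\text{ is pivotal for }\mathcal{C}_n\big)\;\le\;\frac{(\log n)^{d^2-1+\eta_n}}{n^d}.$$
   Context: Graph: $\mathbb{T}_n^d=(\mathbb{Z}/n\mathbb{Z})^d$ is the torus with nearest-neighbour edges (two vertices are adjacent if they differ by $\pm1$ modulo $n$ in exactly one coordinate and agree in all others). Bootstrap percolation with the $2$-neighbour rule: an initial configuration $\omega\in\{-1,1\}^{\mathbb{T}_n^d}$ declares the vertex $v$ initially occupied if $\omega(v)=1$ and vacant if $\omega(v)=-1$. Repeatedly, any vacant vertex having at least $2$ occupied neighbours becomes occupied (occupied vertices stay occupied), until no more changes occur. Complete occupation $\mathcal{C}_n$ is the event that every vertex is eventually occupied. $\mathbb{P}_p$ denotes the product measure on $\{-1,1\}^{\mathbb{T}_n^d}$ under which each bit is independently $1$ with probability $p$ and $-1$ with probability $1-p$. A vertex $x$ is pivotal for $\mathcal{C}_n$ in the configuration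 $\omega$ if exactly one of $\omega$ and $\omega^x$ belongs to $\mathcal{C}_n$, where $\omega^x$ is obtained from $\omega$ by flipping the bit at $x$. *)

(* Defs.v *)
From mathcomp Require Import all_boot all_order all_algebra.
From mathcomp Require Import boolp classical_sets reals.

Set Implicit Arguments.
Unset Strict Implicit.
Unset Printing Implicit Defensive.
Import Order.TTheory GRing.Theory Num.Theory.
Local Open Scope ring_scope.

(* [ordS] is the successor modulo n, so residues are the elements of ['I_n]
   (['Z_n] would be wrong for n < 2). *)
Definition torus (d n : nat) : finType := {ffun 'I_d -> 'I_n}.

(* The condition [u i != v i] only matters for n = 1, where it rules out loops. *)
Definition adj (d n : nat) (u v : torus d n) : bool :=
  [exists i : 'I_d,
    [&& u i != v i,
        (v i == ordS (u i)) || (u i == ordS (v i))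
      & [forall j : 'I_d, (j != i) ==> (u j == v j)]]].

(* [true] encodes the bit 1 (occupied), [false] encodes the bit -1 (vacant). *)
Definition config (d n : nat) : finType := {ffun torus d n -> bool}.

Definition occupied (d n : nat) (w : config d n) : {set torus d n} :=
  finset (fun v => w v).

Definition bootstrap_step (d n : nat) (A : {set torus d n}) : {set torus d n} :=
  A :|: finset (fun v => (2 <= #|[pred u in A | adj v u]|)%N).

Definition complete_occupation (d n : nat) : pred (config d n) :=
  fun w => `[< forall v : torus d n,
                 exists t : nat, v \in iter t (@bootstrap_step d n) (occupied w) >].

Definition flip (d n : nat) (x : torus d n) (w : config d n) : config d n :=
  [ffun v => if v == x then ~~ w v else w v].

Definition pivotal (d n : nat) (E : pred (config d n)) (x : torus d n) :
    pred (config d n) :=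
  fun w => E w != E (flip x w).

Definition Pr (R : realType) (d n : nat) (p : R) (E : pred (config d n)) : R :=
  \sum_(w : config d n | E w) \prod_(v : torus d n) (if w v then p else 1 - p).

(* Main.v *)
(** Write x = ln n and I for the sum over all sites of the probabilities of being
    pivotal; by translation invariance it suffices to estimate I.

    Critical density.  Growing a thin tube from seeds of probability e^(-o(x)) shows
    that p <= x^(-(d-1)+o(1)) unless complete occupation is very likely.  Conversely
    (Aizenman-Lebowitz) complete occupation forces a window of side of order x to
    contain at least x occupied sites, so that p >= x^(-(d-1)-o(1)).

    Lower bound.  The Falik-Samorodnitsky inequality, an entropy form of the theorem of
    Kahn, Kalai and Linial, whose logarithmic Sobolev constant for bias p is of order
    ln (1/p), gives p ln (1/p) I >= c x because all influences are equal.

    Upper bound.  Let h be of order x/p.  With overwhelming probability every segment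
    of h sites contains an occupied one, and then complete occupation means that some
    window of side of order h internally fills a segment of 2h sites.  A bounded
    multiple of disjoint windows covers the torus, so the probabilities r of these local
    events have bounded sum.  For one window of volume v, p(1-p) times the total
    influence is the covariance of the event with the number of occupied sites, hence at
    most of order r sqrt(p v x) by the Gaussian tail of that number.  Summing,
    I <= C sqrt(p h^d x)/p <= x^(d(d+1)/2+o(1)), and d(d+1)/2 <= d^2-1. *)

Require Import Defs.
From mathcomp Require Import all_boot all_order all_algebra.
From mathcomp Require Import boolp reals sequences exp.
From mathcomp Require Import zify ring lra.
Import Order.TTheory GRing.Theory Num.Theory.
Local Open Scope ring_scope.
Set Implicit Arguments.
Unset Strict Implicit.
Unset Printing Implicit Defensive.

(** * Closed sets in the integer lattice *)

(** A closed set is studied through its pullback to the lattice, where it grows by boxes that never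
    meet themselves. The unit of growth is a segment: Aizenman-Lebowitz produces one at each
    prescribed scale, and it sweeps the torus as soon as all segments of its length meet occupied
    sites. Complete occupation thus becomes, up to a negligible event, a union of local events, and
    a vertex pivotal for the union is pivotal for a member. The sum of the probabilities [r] is
    bounded because incomplete occupation has probability above [delta], while events in disjoint
    windows are independent: too many chances could not all fail. The lower bound needs an entropy
    inequality to gain the factor [ln n], which Poincare's inequality lacks; inserting
    [p = x^(-(d-1)+o(1))] gives [x^d]. The exponents [d(d+1)/2] and [d^2-1] agree for [d = 2], so
    there only losses [x^o(1)] can be afforded. All estimates are made at a fixed [eps], uniformly
    in [p], and [eta] is extracted at the very end. *)

Definition coord d (v : {ffun 'I_d -> int}) (i : 'I_d) : int := v i.

(* Rewriting with [ffunE] yields convertible but not syntactically equal forms of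
   the coordinates of a vector, which [lia] would treat as distinct unknowns. *)
Ltac vlia := intros; rewrite ?ffunE; repeat match goal with
  | H : context [@fun_of_fin ?A ?B ?C ?f ?x] |- _ =>
      change (@fun_of_fin A B C f x) with (coord f x) in H
  | |- context [@fun_of_fin ?A ?B ?C ?f ?x] =>
      change (@fun_of_fin A B C f x) with (coord f x)
  end; try match goal with |- @eq _ ?a ?b => change (@eq int a b) end; lia.

Section Lattice.
Variable d : nat.
Notation vec := {ffun 'I_d -> int}.
Implicit Types (u v w lo hi : vec) (i j : 'I_d) (P S : vec -> Prop).

Definition axis i (k : int) : vec := [ffun j => if j == i then k else 0].

Lemma axisE i k j : axis i k j = if j == i then k else 0.
Proof. by rewrite ffunE. Qed.

Lemma vaddE v w j : (v + w) j = v j + w j.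
Proof. by rewrite ffunE. Qed.

Lemma vsubE v w j : (v - w) j = v j - w j.
Proof. by rewrite !ffunE. Qed.

Lemma v0E j : (0 : vec) j = 0.
Proof. by rewrite ffunE. Qed.

Definition vecE := (vsubE, vaddE, axisE, v0E).

Definition unit_step (s : bool) : int := if s then 1 else -1.

Definition zclosed P := forall v i j (s t : bool), (i, s) != (j, t) ->
  P (v + axis i (unit_step s)) -> P (v + axis j (unit_step t)) -> P v.

Definition inbox lo hi v := forall i, lo i <= v i <= hi i.

Lemma axisD i k l : axis i (k + l) = axis i k + axis i l.
Proof. by apply/ffunP => j; rewrite ?vecE ?ffunE; case: eqP => // _; rewrite addr0. Qed.

Lemma axis0 i : axis i 0 = 0.
Proof. by apply/ffunP => j; rewrite ?vecE ?ffunE; case: eqP. Qed.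

Lemma axisN i k : axis i (- k) = - axis i k.
Proof. by apply/ffunP => j; rewrite ?vecE ?ffunE; case: eqP => // _; rewrite oppr0. Qed.

Lemma unit_stepN s : unit_step (~~ s) = - unit_step s.
Proof. by case: s. Qed.

Lemma box_ind lo hi S u : inbox lo hi u -> S u ->
  (forall b j s, inbox lo hi b -> inbox lo hi (b + axis j (unit_step s)) ->
     S b -> S (b + axis j (unit_step s))) ->
  forall v, inbox lo hi v -> S v.
Proof.
move=> bu Su step v.
have [k] := ubnP (\sum_(i < d) `|v i - u i|%N)%N.
elim: k v => // k IH v; rewrite ltnS => hk bv.
have [/forallP E|] := boolP [forall i, v i == u i].
  suff -> : v = u by [].
  by apply/ffunP => i; apply/eqP.
rewrite negb_forall => /existsP[i ne].
pose s := u i < v i.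
pose v' := v - axis i (unit_step s).
have vE : v = v' + axis i (unit_step s) by rewrite /v' subrK.
have bv' : inbox lo hi v'.
  move=> j; rewrite ?vecE ?ffunE; case: eqP => [->|_]; last by rewrite subr0.
  have := bu i; have := bv i; rewrite /s /unit_step.
  by case: (ltP (u i) (v i)); vlia.
have lt : (\sum_(j < d) `|v' j - u j| < \sum_(j < d) `|v j - u j|)%N.
  rewrite (bigD1 i) //= [ltnRHS](bigD1 i) //= /v'.
  rewrite (eq_bigr (fun j => `|v j - u j|%N)); last first.
    by move=> j /negPf ji; rewrite ?vecE ?ffunE ji subr0.
  rewrite ltn_add2r ?vecE ?ffunE eqxx /s /unit_step.
  by case: (ltP (u i) (v i)) ne; vlia.
rewrite vE; apply: step => //; first by rewrite -vE.
by apply: IH => //; exact: leq_trans lt hk.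
Qed.

Lemma lattice_ind S u : S u ->
  (forall b j s, S b -> S (b + axis j (unit_step s))) -> forall v, S v.
Proof.
move=> Su step v.
pose lo : vec := [ffun i => Num.min (u i) (v i)].
pose hi : vec := [ffun i => Num.max (u i) (v i)].
apply: (@box_ind lo hi S u) => //.
- by move=> i; rewrite ?vecE ?ffunE ge_min le_max !lexx.
- by move=> b j s _ _; exact: step.
- by move=> i; rewrite ?vecE ?ffunE ge_min le_max !lexx !orbT.
Qed.

(* The slice at level [c] in direction [i] is full, so a single point of the next
   slice, at level [c + unit_step s], spreads over that slice. *)
Lemma slice_spread P lo hi i (c : int) s : zclosed P ->
  (forall v, v i = c -> (forall j, j != i -> lo j <= v j <= hi j) -> P v) ->
  forall u, u i = c + unit_step s ->
    (forall j, j != i -> lo j <= u j <= hi j) -> P u ->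
  forall v, v i = c + unit_step s ->
    (forall j, j != i -> lo j <= v j <= hi j) -> P v.
Proof.
move=> clP full u ui ub Pu v vi vb.
pose lo' : vec := [ffun j => if j == i then c + unit_step s else lo j].
pose hi' : vec := [ffun j => if j == i then c + unit_step s else hi j].
have inb w : w i = c + unit_step s -> (forall j, j != i -> lo j <= w j <= hi j) ->
    inbox lo' hi' w.
  move=> wi wb j; rewrite ?vecE ?ffunE.
  by case: (eqVneq j i) => [->|/wb //]; rewrite wi lexx.
have outb w : inbox lo' hi' w ->
    w i = c + unit_step s /\ (forall j, j != i -> lo j <= w j <= hi j).
  move=> wb; split; first by have := wb i; rewrite ?vecE ?ffunE eqxx; vlia.
  by move=> j /negPf ji; have := wb j; rewrite ?vecE ?ffunE ji.
apply: (@box_ind lo' hi' P u) => //; [exact: inb| |exact: inb].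
move=> b j t /outb[bi bb] /outb[bi' bb'] Pb.
have ji : j != i.
  by apply/eqP => E; move: bi'; rewrite ?vecE ?ffunE E eqxx bi; case: (t) => /=; vlia.
have ij : i != j by rewrite eq_sym.
apply: (clP _ j i (~~ t) (~~ s)).
- by rewrite xpair_eqE (negPf ji).
- by rewrite unit_stepN axisN addrK.
- rewrite !unit_stepN axisN; apply: full => [|k ki].
    by rewrite ?vecE ?ffunE eqxx (negPf ij) bi addr0 addrK.
  by have := bb' k ki; rewrite ?vecE ?ffunE (negPf ki) subr0.
Qed.

Definition full_box P lo hi := forall v, inbox lo hi v -> P v.

(** The new site either lies in the box already, and then [min] and [max] change nothing, or lies in
    the slice next to it, which [slice_spread] fills. *)
Lemma full_box_extend P lo hi u i s : zclosed P -> full_box P lo hi ->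
  inbox lo hi u -> P (u + axis i (unit_step s)) ->
  exists lo' hi', [/\ full_box P lo' hi',
    inbox lo' hi' (u + axis i (unit_step s)) &
    forall v, inbox lo hi v -> inbox lo' hi' v].
Proof.
move=> clP full bu Pu.
pose c := u i + unit_step s.
pose lo' : vec := [ffun j => if j == i then Num.min (lo j) c else lo j].
pose hi' : vec := [ffun j => if j == i then Num.max (hi j) c else hi j].
have ui := bu i.
exists lo', hi'; split.
- move=> v bv.
  have vi := bv i; rewrite ?vecE ?ffunE eqxx in vi.
  have vb j : j != i -> lo j <= v j <= hi j.
    by move=> /negPf ji; have := bv j; rewrite ?vecE ?ffunE ji.
  have [vc|vc] := eqVneq (v i) c.
    apply: (@slice_spread P lo hi i (u i) s clP _ (u + axis i (unit_step s))) => //.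
    + move=> w wi wb; apply: full => j.
      by case: (eqVneq j i) => [->|/wb//]; rewrite wi.
    + by rewrite ?vecE ?ffunE eqxx.
    + by move=> j /negPf ji; rewrite ?vecE ?ffunE ji addr0.
  apply: full => j; case: (eqVneq j i) => [->|/vb //].
  by move: vi vc; rewrite /c /unit_step; case: (s); vlia.
- move=> j; rewrite ?vecE ?ffunE; case: (eqVneq j i) => [->|_]; last by rewrite addr0.
  by rewrite ge_min le_max /c !lexx !orbT.
- move=> v bv j; rewrite ?vecE ?ffunE; have := bv j.
  by case: eqP => // _; rewrite ge_min le_max => /andP[-> ->].
Qed.

Definition segment P a i (L : nat) := forall k : nat, (k < L)%N -> P (a + axis i k%:Z).

(** The segment is first pushed sideways: each translate in a direction [j] other than [i] meets [P]
    and is filled from its neighbour. The first sites of these translates form an infinite line,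
    whose translates in turn fill the lattice. *)
Lemma segment_fills P a i (L : nat) : zclosed P -> (1 < d)%N -> (0 < L)%N ->
  segment P a i L ->
  (forall b j, exists2 k : nat, (k < L)%N & P (b + axis j k%:Z)) ->
  forall v, P v.
Proof.
move=> clP d1 L0 seg good.
have spread i' j' s (lo hi : int) b k0 : j' != i' -> lo <= k0 <= hi ->
    (forall k, lo <= k <= hi -> P (b + axis i' k)) ->
    P (b + axis j' (unit_step s) + axis i' k0) ->
    forall k, lo <= k <= hi -> P (b + axis j' (unit_step s) + axis i' k).
  move=> ji hk0 full Pk0 k hk.
  have ij : i' != j' by rewrite eq_sym.
  pose l : vec := [ffun t => if t == i' then b t + lo else b t].
  pose h : vec := [ffun t => if t == i' then b t + hi else b t].
  apply: (@slice_spread P l h j' (b j') s clP _ _ _ _ Pk0).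
  - move=> v vj vb.
    have -> : v = b + axis i' (v i' - b i').
      apply/ffunP => t; rewrite ?vecE ?ffunE; case: (eqVneq t i') => [->|ti].
        by rewrite addrC subrK.
      rewrite addr0; case: (eqVneq t j') => [->//|tj].
      by have := vb t tj; rewrite ?vecE ?ffunE (negPf ti); vlia.
    by apply: full; have := vb i' ij; rewrite ?vecE ?ffunE eqxx; vlia.
  - by rewrite ?vecE ?ffunE eqxx (negPf ji) addr0.
  - move=> t tj; rewrite ?vecE ?ffunE (negPf tj); case: eqP => [->|_]; vlia.
  - by rewrite ?vecE ?ffunE eqxx (negPf ji) addr0.
  - move=> t tj; rewrite ?vecE ?ffunE (negPf tj); case: eqP => [->|_]; vlia.
have [j ji] : exists j : 'I_d, j != i.
  have [i0|i0] := eqVneq i (Ordinal d1); last by exists (Ordinal d1); rewrite eq_sym.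
  by exists (Ordinal (ltnW d1)); rewrite i0.
have ij : i != j by rewrite eq_sym.
have line k : P (a + axis j k).
  suff /(_ k 0%N L0) : forall (k : int), segment P (a + axis j k) i L.
    by rewrite axis0 addr0.
  have step k' s : segment P (a + axis j k') i L ->
      segment P (a + axis j (k' + unit_step s)) i L.
    move=> sg t tL; rewrite axisD addrA.
    have [t0 t0L Pt0] := good (a + axis j k' + axis j (unit_step s)) i.
    apply: (@spread i j s 0 (L%:Z - 1) (a + axis j k') t0) => //; [vlia| |vlia].
    move=> [z|z] hz; [apply: sg; vlia|vlia].
  elim/int_ind => [|m IH|m IH]; first by rewrite axis0 addr0.
  - by rewrite -addn1 PoszD; exact: (step _ true).
  - have -> : - (m.+1 : int) = - m%:Z + unit_step false by rewrite /unit_step; vlia.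
    exact: step.
suff H v : forall k, P (v + axis j k).
  by move=> v; have := H v 0; rewrite axis0 addr0.
apply: (@lattice_ind (fun v => forall k, P (v + axis j k)) a line) => b l s Hb k.
have [->|lj] := eqVneq l j; first by rewrite -addrA -axisD; exact: Hb.
have [t0 t0L Pt0] := good (b + axis l (unit_step s)) j.
apply: (@spread j l s (Num.min k t0) (Num.max k t0) b t0) => //.
- by rewrite ge_min le_max !lexx !orbT.
- by rewrite ge_min le_max !lexx.
Qed.

(* A point with two nonzero coordinates has two neighbours with smaller coordinate
   sum. *)
Lemma axes_fill P c i (m : nat) : zclosed P ->
  (forall j (k : nat), j != i -> (k < m)%N -> P (c + axis j k%:Z)) -> P c ->
  forall y : vec, y i = 0 -> (forall j, j != i -> 0 <= y j < m%:Z) -> P (c + y).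
Proof.
move=> clP seeds Pc y.
have [k] := ubnP (\sum_(j < d) `|y j|)%N.
elim: k y => // k IH y; rewrite ltnS => hk yi yb.
have y0 j : 0 <= y j.
  by have [->|/yb/andP[]//] := eqVneq j i; rewrite yi.
have down j : y j != 0 -> P (c + y - axis j 1).
  move=> yj; rewrite -addrA.
  have ji : j != i by apply: contraNneq yj => ->; rewrite yi.
  apply: IH.
  - apply: leq_trans hk.
    rewrite (bigD1 j) //= [ltnRHS](bigD1 j) //=.
    rewrite (eq_bigr (fun t => `|y t|%N)); last first.
      by move=> t /negPf tj; rewrite ?vecE ?ffunE tj subr0.
    rewrite ltn_add2r ?vecE ?ffunE eqxx; have := y0 j; move: yj; vlia.
  - by rewrite ?vecE ?ffunE eq_sym (negPf ji) yi subr0.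
  - move=> t ti; rewrite ?vecE ?ffunE; have := yb t ti.
    by case: eqP => [->|_]; [have := y0 j; move: yj|]; vlia.
have [/existsP[j /existsP[l /and3P[jl yj yl]]]|] :=
    boolP [exists j, exists l, [&& j != l, y j != 0 & y l != 0]].
  apply: (clP _ j l false false); first by rewrite xpair_eqE (negPf jl).
  - by rewrite /unit_step axisN; exact: down.
  - by rewrite /unit_step axisN; exact: down.
move=> H.
have [/forallP y00|] := boolP [forall j, y j == 0].
  have -> : y = 0 by apply/ffunP => j; rewrite ?vecE; apply/eqP; exact: y00.
  by rewrite addr0.
rewrite negb_forall => /existsP[j yj].
have -> : y = axis j `|y j|%N.
  apply/ffunP => l; rewrite ?vecE ?ffunE; case: (eqVneq l j) => [->|lj].
    by have := y0 j; vlia.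
  apply/eqP; apply: contraNT H => yl.
  by apply/existsP; exists j; apply/existsP; exists l; rewrite eq_sym lj yj yl.
have ji : j != i by apply: contraNneq yj => ->; rewrite yi.
by apply: seeds => //; have := yb j ji; vlia.
Qed.

(** Seeds on the axes are linear in [m] in number, whereas the base of the tube has [m^(d-1)] sites;
    this keeps a nucleus affordable. Each later layer touches a full one and needs a single site. *)
Lemma tube_fills P c i (m L : nat) : zclosed P ->
  (forall j (k : nat), j != i -> (k < m)%N -> P (c + axis j k%:Z)) -> P c ->
  (0 < m)%N ->
  (forall k : nat, (0 < k < L)%N -> exists2 y : vec,
     y i = k%:Z /\ (forall j, j != i -> 0 <= y j < m%:Z) & P (c + y)) ->
  segment P c i L.
Proof.
move=> clP seeds Pc m0 layers.
suff H (k : nat) : (k < L)%N -> forall y : vec, y i = k%:Z ->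
    (forall j, j != i -> 0 <= y j < m%:Z) -> P (c + y).
  move=> k kL; apply: H kL _ _ _; first by rewrite ?vecE eqxx.
  by move=> j /negPf ji; rewrite ?vecE ji; vlia.
elim: k => [_|k IH kL] y yi yb; first exact: (axes_fill clP seeds Pc).
have [y0 [y0i y0b] Py0] := layers k.+1 kL.
pose hi : vec := [ffun j => c j + m%:Z - 1].
apply: (@slice_spread P c hi i (c i + k%:Z) true clP _ (c + y0)) => //.
- move=> v vi vb; have -> : v = c + (v - c) by rewrite addrC subrK.
  apply: IH; first exact: ltnW.
  + by rewrite ?vecE ?ffunE vi; vlia.
  + by move=> j ji; have := vb j ji; rewrite ?vecE ?ffunE; vlia.
- by rewrite ?vecE ?ffunE y0i /unit_step; vlia.
- by move=> j ji; have := y0b j ji; rewrite ?vecE ?ffunE; vlia.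
- by rewrite ?vecE ?ffunE yi /unit_step; vlia.
- by move=> j ji; have := yb j ji; rewrite ?vecE ?ffunE; vlia.
Qed.

End Lattice.

(** * Closed sets in the torus *)

Section Closure.
Variables d n : nat.
Local Notation V := (torus d n).
Implicit Types (A B X : {set V}) (u v : V).

Definition closed2 X := bootstrap_step X \subset X.

Lemma closed2P X :
  reflect (forall v u1 u2, u1 \in X -> u2 \in X -> adj v u1 -> adj v u2 ->
             u1 != u2 -> v \in X) (closed2 X).
Proof.
apply: (iffP subsetP) => [clX v u1 u2 X1 X2 a1 a2 ne|clX v].
  apply: clX; rewrite !inE; apply/orP; right; apply/card_gt1P.
  by exists u1, u2; split; rewrite ?inE ?X1 ?X2.
rewrite !inE => /orP[//|/card_gt1P[u1 [u2 []]]].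
by rewrite !inE => /andP[X1 a1] /andP[X2 a2]; exact: clX.
Qed.

Definition cl A : {set V} := \bigcap_(X : {set V} | closed2 X && (A \subset X)) X.

Lemma sub_cl A : A \subset cl A.
Proof. by apply/bigcapsP => X /andP[]. Qed.

Lemma cl_min A X : closed2 X -> A \subset X -> cl A \subset X.
Proof. by move=> cX AX; apply: bigcap_inf; rewrite cX. Qed.

Lemma cl_closed A : closed2 (cl A).
Proof.
apply/closed2P => v u1 u2 /bigcapP c1 /bigcapP c2 a1 a2 ne.
apply/bigcapP => X PX; have /andP[/closed2P cX _] := PX.
exact: (cX v u1 u2 (c1 X PX) (c2 X PX)).
Qed.

Lemma cl_mono A B : A \subset B -> cl A \subset cl B.
Proof.
by move=> AB; apply: cl_min; [exact: cl_closed|exact: subset_trans AB (sub_cl B)].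
Qed.

(** From here on time disappears: the final state is the least closed set, which makes monotonicity,
    translation and locality immediate. *)
Lemma complete_occupationE (w : config d n) :
  complete_occupation w = (cl (occupied w) == [set: V]).
Proof.
apply/asboolP/eqP => [full|clT v].
  apply/eqP; rewrite eqEsubset subsetT /=; apply/subsetP => v _.
  have [t] := full v; elim: t v => [|t IH] v /=; first exact/subsetP/sub_cl.
  move=> vt; apply: (subsetP (cl_closed _)); apply: (subsetP _ _ vt).
  apply/subsetP => x; rewrite !inE => /orP[/IH ->//|h]; apply/orP; right.
  apply: leq_trans h _; apply: subset_leq_card; apply/subsetP => y.
  by rewrite !inE => /andP[/IH -> ->].
pose Y : {set V} :=
  [set v | `[< exists t, v \in iter t (@bootstrap_step d n) (occupied w) >]].
have mono s t : (s <= t)%N -> iter s (@bootstrap_step d n) (occupied w)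
    \subset iter t (@bootstrap_step d n) (occupied w).
  move=> /subnK <-; elim: (t - s)%N => // k IH.
  by rewrite addSn iterS; apply: subset_trans IH _; rewrite subsetUl.
have : v \in cl (occupied w) by rewrite clT inE.
suff sY : cl (occupied w) \subset Y.
  by move=> /(subsetP sY); rewrite inE => /asboolP.
apply: cl_min; last by apply/subsetP => x xo; rewrite inE; apply/asboolP; exists 0%N.
apply/closed2P => x u1 u2; rewrite !inE => /asboolP[t1 h1] /asboolP[t2 h2] a1 a2 ne.
apply/asboolP; exists (maxn t1 t2).+1; rewrite iterS !inE; apply/orP; right.
apply/card_gt1P; exists u1, u2; split; rewrite ?inE ?a1 ?a2 ?andbT //.
- exact: (subsetP (mono _ _ (leq_maxl _ _))).
- exact: (subsetP (mono _ _ (leq_maxr _ _))).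
Qed.

End Closure.

(** * Reduction of the lattice modulo the side, and windows *)

Section Torus.
Variables d m : nat.
Local Notation n := m.+3.
Local Notation V := {ffun 'I_d -> 'I_m.+3}.
Local Notation vec := {ffun 'I_d -> int}.
Implicit Types (T X Y : {set torus d m.+3}) (x y z : V) (u v : vec).

(** The side is [m.+3] because from side 3 on the [2 d] unit steps stay distinct modulo the side
    ([pr_step_inj]); with side 2 both steps along an axis reach the same vertex. *)
Definition pr u : V := [ffun i => (u i)%:~R].

Lemma prD u v : pr (u + v) = pr u + pr v.
Proof. by apply/ffunP => i; rewrite !ffunE rmorphD. Qed.

Lemma pr0 : pr 0 = 0.
Proof. by apply/ffunP => j; rewrite !ffunE. Qed.

Definition lift_pt x : vec := [ffun i => Posz (x i)].

Lemma lift_ptK x : pr (lift_pt x) = x.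
Proof. by apply/ffunP => i; rewrite !ffunE -pmulrn natr_Zp. Qed.

Lemma ordSE (a : 'I_m.+3) : ordS a = a + 1.
Proof. by apply/val_inj; rewrite /= [(1 %% _)%N]modn_small // addn1. Qed.

Lemma adjP x y : reflect (exists i s, y = x + pr (axis i (unit_step s)))
  (@adj d m.+3 x y).
Proof.
apply: (iffP existsP) => [[i /and3P[ne st /forallP eqs]]|[i [s ->]]].
  have other j : j != i -> y j = x j.
    by move=> ji; apply/esym/eqP/(implyP (eqs j)).
  case/orP: st => /eqP; rewrite ordSE => E; exists i.
    exists true; apply/ffunP => j; rewrite !ffunE.
    by case: eqP => [->|/eqP /other ->]; rewrite ?addr0.
  exists false; apply/ffunP => j; rewrite !ffunE.
  case: eqP => [->|/eqP /other ->]; last by rewrite addr0.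
  by rewrite E addrK.
exists i; rewrite !ffunE eqxx /= !ordSE.
have -> : (x i != x i + (unit_step s)%:~R).
  rewrite -subr_eq0 opprD addrA subrr add0r oppr_eq0.
  by case: s; rewrite ?rmorphN ?oppr_eq0 rmorph1 oner_eq0.
case: s => /=; rewrite ?rmorphN rmorph1 ?subrK eqxx ?orbT /=;
  by apply/forallP => j; apply/implyP => /negPf ji; rewrite !ffunE ji addr0.
Qed.

Lemma adj_sym x y : @adj d m.+3 x y = @adj d m.+3 y x.
Proof.
suff H x' y' : @adj d m.+3 x' y' -> @adj d m.+3 y' x' by apply/idP/idP; exact: H.
move=> /adjP[i [s ->]]; apply/adjP; exists i, (~~ s).
by rewrite -addrA -prD unit_stepN axisN subrr pr0 addr0.
Qed.

Lemma int_mod_eq0 (e : int) : e%:~R = 0 :> 'I_m.+3 -> (n %| `|e|)%N.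
Proof.
have nat0 (k : nat) : k%:R = 0 :> 'I_m.+3 -> (n %| k)%N.
  move=> /(congr1 val) /=; rewrite [in X in X -> _]Zp_nat /= => E.
  by rewrite /dvdn E.
case: e => k /=; first by move/nat0.
by rewrite NegzE rmorphN => /eqP; rewrite oppr_eq0 => /eqP /nat0.
Qed.

Lemma int_mod_inj (e f : int) : e%:~R = f%:~R :> 'I_m.+3 -> (`|e - f| < n)%N -> e = f.
Proof.
move=> /eqP; rewrite -subr_eq0 -rmorphB /= => /eqP/int_mod_eq0 dv lt.
have [//|ne] := eqVneq e f.
by have := dvdn_leq _ dv; lia.
Qed.

Lemma pr_step_inj (i j : 'I_d) (s t : bool) :
  pr (axis i (unit_step s)) = pr (axis j (unit_step t)) -> (i, s) = (j, t).
Proof.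
move=> /ffunP /(_ i); rewrite !ffunE eqxx.
have [->|_] := eqVneq i j; last by case: s => /int_mod_inj; rewrite /unit_step; lia.
by case: s; case: t => // /int_mod_inj; rewrite /unit_step; lia.
Qed.

Definition pullback X (b : V) : vec -> Prop := fun u => b + pr u \in X.

Lemma pullback_closed X b : closed2 X -> zclosed (pullback X b).
Proof.
move=> /closed2P clX u i j s t ne; rewrite /pullback !prD !addrA => h1 h2.
apply: clX h1 h2 _ _ _; first by apply/adjP; exists i, s.
  by apply/adjP; exists j, t.
apply: contraNneq ne => E; apply/eqP/pr_step_inj.
exact: addrI E.
Qed.

(** Distance at most [k] in the maximum norm of the torus. The offset [e - k] ranges over a finite
    type to make the relation boolean; for large [k] several offsets may agree modulo the side. *)
Definition close_to k x y : bool :=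
  [forall i, [exists e : 'I_k.*2.+1, y i == x i + (Posz e - k%:Z)%:~R]].

Lemma close_toP k x y :
  reflect (forall i, exists2 e : int, (`|e| <= k)%N & y i = x i + e%:~R)
          (close_to k x y).
Proof.
apply: (iffP forallP) => H i.
  have /existsP[e /eqP ->] := H i; exists (Posz e - k%:Z) => //.
  by have := ltn_ord e; lia.
have [e he E] := H i; apply/existsP.
have le : (`|(e + k%:Z)%R|%N < k.*2.+1)%N by lia.
exists (Ordinal le) => /=; rewrite E; apply/eqP; congr (_ + _%:~R); lia.
Qed.

Lemma close_to_refl k x : close_to k x x.
Proof. by apply/close_toP => i; exists 0; rewrite ?addr0. Qed.

Lemma close_to_sym k x y : close_to k x y -> close_to k y x.
Proof.
move=> /close_toP H; apply/close_toP => i; have [e he ->] := H i.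
by exists (- e); rewrite ?abszN // rmorphN addrK.
Qed.

Lemma close_to_trans k l x y z : close_to k x y -> close_to l y z -> close_to (k + l) x z.
Proof.
move=> /close_toP H /close_toP H'; apply/close_toP => i.
have [e he E] := H i; have [e' he' ->] := H' i.
by exists (e + e'); [lia|rewrite rmorphD /= addrA E].
Qed.

Lemma close_to_leq k l x y : (k <= l)%N -> close_to k x y -> close_to l x y.
Proof.
move=> kl /close_toP H; apply/close_toP => i; have [e he E] := H i.
by exists e => //; exact: leq_trans kl.
Qed.

Lemma adj_close_to x y : @adj d m.+3 x y -> close_to 1 x y.
Proof.
move=> /adjP[i [s ->]]; apply/close_toP => j; rewrite !ffunE.
by exists (if j == i then unit_step s else 0) => //; case: eqP => //; case: s.
Qed.

Definition window k x : {set torus d m.+3} := [set y | close_to k x y].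

Definition has_segment L X : bool :=
  [exists x : torus d m.+3, exists i : 'I_d,
     [forall k : 'I_L, x + pr (axis i k%:Z) \in X]].

Lemma has_segmentP L X :
  reflect (exists b i, segment (pullback X b) 0 i L) (has_segment L X).
Proof.
apply: (iffP existsP) => [[x /existsP[i /forallP H]]|[b [i H]]].
  by exists x, i => k kL; rewrite /pullback add0r; exact: H (Ordinal kL).
exists b; apply/existsP; exists i; apply/forallP => k.
by have := H k (ltn_ord k); rewrite /pullback add0r.
Qed.

Lemma has_segment_sub L X Y : X \subset Y -> has_segment L X -> has_segment L Y.
Proof.
move=> /subsetP XY /has_segmentP[b [i H]]; apply/has_segmentP; exists b, i => k kL.
exact/XY/H.
Qed.

Lemma card_window_le k x : (#|window k x| <= k.*2.+1 ^ d)%N.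
Proof.
have -> : (k.*2.+1 ^ d = #|{ffun 'I_d -> 'I_k.*2.+1}|)%N.
  by rewrite card_ffun !card_ord.
rewrite -cardsT.
pose f (g : {ffun 'I_d -> 'I_k.*2.+1}) : torus d m.+3 :=
  x + pr [ffun i => Posz (g i) - k%:Z].
apply: leq_trans (leq_imset_card f _); apply: subset_leq_card.
apply/subsetP => y; rewrite inE => /forallP H; apply/imsetP.
exists [ffun i => xchoose (existsP (H i))] => //.
apply/ffunP => i; rewrite !ffunE; apply/eqP.
exact: (xchooseP (existsP (H i))).
Qed.

(** Only nonnegative offsets are counted: below the side they are distinct, while the two halves of
    a window may overlap around the torus. *)
Lemma card_window_ge k x : (k < n)%N -> (k.+1 ^ d <= #|window k x|)%N.
Proof.
move=> kn.
have -> : (k.+1 ^ d = #|{ffun 'I_d -> 'I_k.+1}|)%N.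
  by rewrite card_ffun !card_ord.
pose f (g : {ffun 'I_d -> 'I_k.+1}) : torus d m.+3 := x + pr [ffun i => Posz (g i)].
have finj : injective f.
  move=> g h /addrI /ffunP E; apply/ffunP => i; apply/ord_inj.
  have := E i; rewrite !ffunE => /int_mod_inj.
  have := ltn_ord (g i); have := ltn_ord (h i).
  move: (nat_of_ord (g i)) (nat_of_ord (h i)) => a b hb ha ab.
  have lt : (`|(a%:Z - b%:Z)%R|%N < n)%N by lia.
  by case: (ab lt).
rewrite -cardsT -(card_imset _ finj); apply: subset_leq_card.
apply/subsetP => _ /imsetP[g _ ->]; rewrite inE; apply/close_toP => i.
exists (Posz (g i)); [by rewrite -ltnS; exact: ltn_ord|by rewrite !ffunE].
Qed.

End Torus.
Arguments pr {d m} u.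

(** * Growth of connected sets, and tubes *)

Section Growth.
Variables d m : nat.
Local Notation n := m.+3.
Local Notation V := {ffun 'I_d -> 'I_m.+3}.
Local Notation site := (torus d m.+3).
Local Notation vec := {ffun 'I_d -> int}.
Implicit Types (A S T X Y : {set torus d m.+3}) (x y z : V) (u v : vec).

Definition induced_adj T : rel site := [rel x y | [&& adj x y, x \in T & y \in T]].

Definition connected_set T := forall x y, x \in T -> y \in T -> connect (induced_adj T) x y.

Lemma induced_adj_sym T : connect_sym (induced_adj T).
Proof.
apply: sym_connect_sym => x y; rewrite /induced_adj /= adj_sym; congr (_ && _); exact: andbC.
Qed.

Lemma connected_set1 x : connected_set [set x].
Proof. by move=> y z; rewrite !inE => /eqP -> /eqP ->; exact: connect0. Qed.

Lemma connected_setU T1 T2 x y : connected_set T1 -> connected_set T2 ->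
  x \in T1 -> y \in T2 -> @adj d n x y -> connected_set (T1 :|: T2).
Proof.
move=> c1 c2 x1 y2 xy.
have sub T T' : T \subset T' ->
    subrel (connect (induced_adj T)) (connect (induced_adj T')).
  move=> /subsetP TT'; apply: connect_sub => a b /and3P[ab aT bT].
  by apply: connect1; rewrite /induced_adj /= ab !TT'.
have toy z : z \in T1 :|: T2 -> connect (induced_adj (T1 :|: T2)) z y.
  rewrite inE => /orP[z1|z2].
    apply: connect_trans (sub _ _ (subsetUl T1 T2) _ _ (c1 z x z1 x1)) _.
    by apply: connect1; rewrite /induced_adj /= xy !inE x1 y2 orbT.
  exact: sub _ _ (subsetUr T1 T2) _ _ (c2 z y z2 y2).
move=> a b aT bT; apply: connect_trans (toy a aT) _.
by rewrite induced_adj_sym; exact: toy.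
Qed.

(** Along a path from [x] to [y], lifted to the lattice, a full box grows that always contains the
    origin and the current endpoint [w]. As [x] and [y] are not close, some coordinate of the final
    [w] exceeds [L] in absolute value, and the box contains a segment spanning it. *)
Lemma connected_segment X T x y L : closed2 X -> T \subset X -> connected_set T ->
  x \in T -> y \in T -> ~~ close_to L x y -> has_segment L.+1 X.
Proof.
move=> clX TX conT xT yT nxy.
have clP := @pullback_closed _ _ X x clX.
have [p pp yE] := connectP (conT x y xT yT).
have [w [lo [hi [yw full b0 bw]]]] : exists w lo hi, [/\ y = x + pr w,
    full_box (pullback X x) lo hi, inbox lo hi 0 & inbox lo hi w].
  rewrite yE; elim/last_ind: p pp {yE nxy yT} => [_|p z IH].
    exists 0, 0, 0; split; first by rewrite pr0 addr0.
    move=> v bv; have -> : v = 0 by apply/ffunP => i; have := bv i; rewrite !v0E; vlia.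
    by rewrite /pullback pr0 addr0 (subsetP TX).
    1-2: by move=> i; rewrite v0E lexx.
  rewrite rcons_path last_rcons => /andP[/IH[w [lo [hi [Ew full b0 bw]]]]].
  move=> /and3P[/adjP[i [s ->]] _ zT].
  have [|lo' [hi' [full' bw' sub]]] := full_box_extend clP full bw (i := i) (s := s).
    rewrite /pullback prD addrA -Ew; move: zT; exact: (subsetP TX).
  exists (w + axis i (unit_step s)), lo', hi'; split=> //; last exact: sub.
  by rewrite prD addrA Ew.
have [i wi] : exists i, (L < `|w i|)%N.
  apply/existsP; rewrite -[X in is_true X]negbK; apply: contra nxy.
  rewrite negb_exists => /forallP H; apply/close_toP => i.
  by exists (w i); [rewrite leqNgt|rewrite yw !ffunE].
apply/has_segmentP.
have := bw i; have := b0 i; rewrite v0E => hb0 hbw.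
have inb u k : inbox lo hi u -> lo i <= u i + k <= hi i -> inbox lo hi (u + axis i k).
  move=> bu bk j; rewrite vaddE axisE; case: (eqVneq j i) => [->//|_].
  by rewrite addr0; exact: bu.
have pb c u (k : nat) : pullback X (x + pr c) (u + axis i k%:Z) =
    pullback X x (c + (u + axis i k%:Z)).
  by rewrite /pullback [in RHS]prD addrA.
(* Segments run in the increasing direction, so this one starts at whichever of [0] and [w] has the
   smaller coordinate. *)
have [w0|w0] := ltP (w i) 0.
  exists (x + pr w), i => k kL; rewrite pb add0r.
  by apply: full; apply: inb => //; lia.
exists (x + pr 0), i => k kL; rewrite pb add0r.
by apply: full; apply: inb => //; rewrite v0E; lia.
Qed.

Lemma segment_fills_torus X L : closed2 X -> (1 < d)%N -> (0 < L)%N ->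
  has_segment L X ->
  (forall x i, exists2 k : nat, (k < L)%N & x + pr (axis i k%:Z) \in X) ->
  X = [set: site].
Proof.
move=> clX d1 L0 /has_segmentP[b [i seg]] hit.
apply/eqP; rewrite eqEsubset subsetT /=; apply/subsetP => y _.
have -> : y = b + pr (lift_pt (y - b)) by rewrite lift_ptK addrC subrK.
apply: (segment_fills (@pullback_closed _ _ X b clX) d1 L0 seg) => v j.
have [k kL h] := hit (b + pr v) j.
by exists k => //; rewrite /pullback prD addrA.
Qed.

Lemma neighbour_closed_full T x : x \in T ->
  (forall y z, y \in T -> @adj d n y z -> z \in T) -> T = [set: site].
Proof.
move=> xT step; apply/eqP; rewrite eqEsubset subsetT /=; apply/subsetP => y _.
have -> : y = x + pr (lift_pt (y - x)) by rewrite lift_ptK addrC subrK.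
apply: (@lattice_ind _ (pullback T x) 0); first by rewrite /pullback pr0 addr0.
move=> b j s h; apply: (step (x + pr b)) => //; apply/adjP; exists j, s.
by rewrite prD addrA.
Qed.

(* If no connected, internally spanned set has diameter between [l + 1] and
   [2 l + 2], then those of diameter at most [l] are stable under merging, so their
   union is closed, hence everything, and a largest one has no room to be maximal. *)
Theorem aizenman_lebowitz A l : (0 < d)%N -> (l.*2.+1 < n)%N -> cl A = [set: site] ->
  exists x, has_segment l.+1 (cl (A :&: window l.*2.+2 x)).
Proof.
move=> d0 ln clA.
have [/existsP[x ?]|] := boolP [exists x : site, has_segment l.+1 (cl (A :&: window l.*2.+2 x))].
  by exists x.
rewrite negb_exists => /forallP noseg; exfalso.
pose small k T := forall x y, x \in T -> y \in T -> close_to k x y.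
pose good T := connected_set T /\ T \subset cl (A :&: T).
(* The gap in diameters: a spanned connected set inside a window of radius [2 l + 2] that has two
   sites not within [l] of each other would produce the excluded segment. *)
have shrink T : good T -> small l.*2.+2 T -> small l T.
  move=> [conT spT] smT x y xT yT; apply: contraT => nxy.
  case/negP: (noseg x).
  apply: (connected_segment (cl_closed _) _ conT xT yT nxy).
  apply: subset_trans spT _; apply: cl_mono; apply: setIS.
  by apply/subsetP => z zT; rewrite inE; exact: smT.
have spU T1 T2 : T1 \subset cl (A :&: T1) -> T2 \subset cl (A :&: T2) ->
    T1 :|: T2 \subset cl (A :&: (T1 :|: T2)).
  move=> s1 s2; rewrite subUset; apply/andP; split.
    by apply: subset_trans s1 _; apply/cl_mono/setIS/subsetUl.
  by apply: subset_trans s2 _; apply/cl_mono/setIS/subsetUr.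
pose F : pred {set site} := fun T => `[< good T /\ small l T >].
pose U : {set site} := \bigcup_(T | F T) T.
have F1 x : x \in A -> F [set x].
  move=> xA; apply/asboolP; split; first split; first exact: connected_set1.
    by apply: subset_trans (sub_cl _); rewrite sub1set !inE xA eqxx.
  by move=> y z; rewrite !inE => /eqP -> /eqP ->; exact: close_to_refl.
have clU : closed2 U.
  apply/closed2P => v u1 u2 /bigcupP[T1 F1' x1] /bigcupP[T2 F2 x2] a1 a2 ne.
  have /asboolP[[c1 s1] r1] := F1'; have /asboolP[[c2 s2] r2] := F2.
  pose T := T1 :|: ([set v] :|: T2).
  have conT : connected_set T.
    apply: (@connected_setU _ _ u1 v) => //; last 1 first.
    - by rewrite adj_sym.
    - by apply: (@connected_setU _ _ v u2) => //; [exact: connected_set1|rewrite inE].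
    - by rewrite !inE eqxx.
  have spT : T \subset cl (A :&: T).
    have s12 := spU _ _ s1 s2.
    have sub12 : cl (A :&: (T1 :|: T2)) \subset cl (A :&: T).
      by apply/cl_mono/setIS/setUS/subsetUr.
    have sT := subset_trans s12 sub12.
    apply/subsetP => y; rewrite !inE => /or3P[y1|/eqP ->|y2].
    - by apply: (subsetP sT); rewrite inE y1.
    - have /closed2P := cl_closed (A :&: T); apply; last exact: ne.
      + by apply: (subsetP sT); rewrite inE x1.
      + by apply: (subsetP sT); rewrite inE x2 orbT.
      + by [].
      + by [].
    - by apply: (subsetP sT); rewrite inE y2 orbT.
  (* Every site of the merged set is within [l + 1] of [v], so any two are within [2 l + 2] and
     [shrink] applies. *)
  have n1 y : y \in T1 -> close_to l.+1 y v.
    by move=> y1; rewrite -addn1; apply: close_to_trans (r1 _ _ y1 x1) _;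
       apply: adj_close_to; rewrite adj_sym.
  have n2 y : y \in T2 -> close_to l.+1 v y.
    by move=> y2; rewrite -add1n; apply: close_to_trans (r2 _ _ x2 y2); exact: adj_close_to.
  have dl : (l.*2.+2 = l.+1 + l.+1)%N by rewrite addnS addSn addnn.
  have nv y : y \in T -> close_to l.+1 y v.
    rewrite !inE => /or3P[/n1//|/eqP ->|/n2 /close_to_sym //]; exact: close_to_refl.
  apply/bigcupP; exists T; last by rewrite !inE eqxx orbT.
  apply/asboolP; split => //; apply: shrink => // y z yT zT.
  by rewrite dl; apply: close_to_trans (nv y yT) _; apply/close_to_sym/nv.
have UT : U = [set: site].
  apply/eqP; rewrite eqEsubset subsetT /= -clA; apply: cl_min => //.
  by apply/subsetP => x xA; apply/bigcupP; exists [set x]; rewrite ?inE // F1.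
have [x0 x0A] : exists x, x \in A.
  apply/set0Pn; apply/eqP => A0; have : (0 : V) \in cl A by rewrite clA inE.
  suff /subsetP H : cl A \subset set0 by move/H; rewrite inE.
  by rewrite A0; apply: cl_min => //; apply/closed2P => ? ? ?; rewrite inE.
case: (@arg_maxnP _ [set x0] F (fun T : {set site} => #|T|) (F1 x0 x0A)) => M0 FM0 maxM0.
have /asboolP[[c0 s0] r0] := FM0.
(* A set of diameter at most [l] is not the torus: an offset [e] of size at most [l] leading to the
   site [l + 1] away on an axis would differ from [l + 1] by at most [2 l + 1], less than the
   side. *)
have [M0T|M0n] := eqVneq M0 [set: site].
  have := r0 0 (pr (axis (Ordinal d0) l.+1%:Z)); rewrite M0T !inE.
  move=> /(_ isT isT) /close_toP /(_ (Ordinal d0))[e he]; rewrite !ffunE eqxx add0r.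
  move=> E; have lt : (`|(Posz l.+1 - e)%R|%N < n)%N by lia.
  by have := int_mod_inj E lt; lia.
have [x1 x1T] : exists x, x \in M0.
  have : (0 < #|M0|)%N by apply: leq_trans (maxM0 _ (F1 x0 x0A)); rewrite cards1.
  by move/card_gt0P.
have [y [z [yT yz zT]]] : exists y z, [/\ y \in M0, @adj d n y z & z \notin M0].
  apply: contra_neqP M0n => H; apply: (neighbour_closed_full x1T) => y z yT yz.
  by apply: contra_notT H => zT; exists y, z.
have : z \in U by rewrite UT inE.
case/bigcupP => T1 FT1 zT1; have /asboolP[[c1 s1] r1] := FT1.
have FU : F (M0 :|: T1).
  apply/asboolP; have gU : good (M0 :|: T1).
    by split; [exact: (connected_setU c0 c1 yT zT1 yz)|exact: spU].
  split => //; apply: shrink => // a b.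
  have nz a' : a' \in M0 :|: T1 -> close_to l.+1 a' z.
    rewrite inE => /orP[a0|a1]; last exact: close_to_leq (leqnSn l) (r1 _ _ a1 zT1).
    by rewrite -addn1; apply: close_to_trans (r0 _ _ a0 yT) _; exact: adj_close_to.
  move=> /nz na /nz nb.
  have -> : (l.*2.+2 = l.+1 + l.+1)%N by rewrite addnS addSn addnn.
  by apply: close_to_trans na _; exact: close_to_sym.
have := maxM0 _ FU; apply/negP; rewrite -ltnNge; apply: proper_card.
rewrite properE subsetUl /=; apply/subsetPn; exists z => //; by rewrite inE zT1 orbT.
Qed.

(* Two consecutive empty layers stay empty. *)
Lemma segment_card S L : (L <= n)%N -> has_segment L (cl S) -> (L./2 <= #|S|)%N.
Proof.
move=> Ln /has_segmentP[b [i seg]].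
(* [g] groups the layers across the segment in consecutive pairs. [S] must meet each of [L./2]
   pairs, for otherwise the complement of that pair is a closed set containing [S]. *)
pose g x : nat := (nat_of_ord (x i - b i))./2.
have hit j : (j < L./2)%N -> exists2 x, x \in S & g x = j.
  move=> jL; pose Y : {set site} :=
    [set x : site | ((x : V) i != b i + j.*2%:R) && ((x : V) i != b i + j.*2.+1%:R)].
  have clY : closed2 Y.
    apply/closed2P => v u1 u2 u1Y u2Y /adjP[i1 [s1 E1]] /adjP[i2 [s2 E2]] ne.
    apply: contraT => vY.
    (* A vertex of the two layers has at most one neighbour outside them, in direction [i] and with
       a sign decided by its layer. *)
    have Hdir (u : site) k s : u \in Y -> u = v + pr (axis k (unit_step s)) -> k = i /\
        s = (v i != b i + j.*2%:R).
      move=> uY uE; have [ki|ki] := eqVneq i k; last first.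
        move: uY vY; rewrite uE !inE !ffunE (negPf ki) addr0 => ->; by [].
      split => //; subst k; move: uY vY; rewrite uE !inE !ffunE eqxx negb_and !negbK.
      rewrite -[j.*2.+1]addn1 natrD addrA.
      move=> /andP[h1 h2]; case: (eqVneq ((v : V) i) (b i + j.*2%:R)) h1 h2 => [->|_].
        by case: (s) => //=; rewrite eqxx.
      by move=> /= h1 _ /eqP E; move: h1; rewrite E; case: (s) => //=; rewrite addrK eqxx.
    have [k1 t1] := Hdir _ _ _ u1Y E1; have [k2 t2] := Hdir _ _ _ u2Y E2.
    by case/eqP: ne; rewrite E1 E2 k1 k2 t1 t2.
  have [/existsP[x /andP[xS xg]]|] := boolP [exists x, (x \in S) && (g x == j)].
    by exists x => //; exact/eqP.
  rewrite negb_exists => /forallP noS; exfalso.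
  have SY : S \subset Y.
    apply/subsetP => x xS; have := noS x; rewrite xS /= inE /g.
    apply: contraR; rewrite negb_and !negbK => /orP[] /eqP ->;
      by rewrite addrC addKr Zp_nat /= modn_small ?doubleK ?uphalf_double //; lia.
  have : b + pr (0 + axis i j.*2%:Z) \in Y.
    by apply: (subsetP (cl_min clY SY)); apply: seg; lia.
  by rewrite add0r inE !ffunE eqxx pmulrn eqxx.
rewrite -(size_iota 0 L./2) cardE -(size_map g).
apply: uniq_leq_size; first exact: iota_uniq.
move=> j; rewrite mem_iota add0n => /andP[_ /hit[x xS <-]].
by apply: map_f; rewrite mem_enum.
Qed.

Definition meets_segments L A : bool :=
  [forall x : site, forall i : 'I_d, exists k : 'I_L, x + pr (axis i (Posz k)) \in A].

Lemma meets_segmentsP L A : reflect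
  (forall x i, exists2 k : nat, (k < L)%N & x + pr (axis i k%:Z) \in A)
  (meets_segments L A).
Proof.
apply: (iffP forallP) => H x.
  move=> i; have /forallP/(_ i)/existsP[k h] := H x; by exists k.
apply/forallP => i; have [k kL h] := H x i.
by apply/existsP; exists (Ordinal kL).
Qed.

(** A segment of length [2 L] splits into two disjoint ones of length [L], and the flip at [z]
    empties at most one of them. *)
Lemma meets_segments_flip L (z : site) (w : config d n) : (L.*2 <= n)%N ->
  meets_segments L (occupied w) -> meets_segments L.*2 (occupied (flip z w)).
Proof.
move=> Ln /meets_segmentsP H; apply/meets_segmentsP => x i.
have [k1 k1L h1] := H x i.
have [k2 k2L h2] := H (x + pr (axis i L%:Z)) i.
have keep (y : site) : y \in occupied w -> y != z -> y \in occupied (flip z w).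
  by rewrite !inE ffunE => h /negPf ->.
have [E1|ne] := eqVneq (x + pr (axis i k1%:Z)) z; last first.
  by exists k1; [lia|exact: keep].
exists (L + k2)%N; first lia.
rewrite PoszD axisD prD addrA; apply: keep => //.
rewrite -E1 -addrA; apply/eqP => /addrI; rewrite -prD -axisD => /ffunP /(_ i).
by rewrite !ffunE eqxx => /int_mod_inj; lia.
Qed.

Definition tube_seeds (c : site) (i : 'I_d) (k : nat) : {set site} :=
  [set (c : V) + pr (axis q.1 (Posz q.2)) | q : 'I_d * 'I_k & q.1 != i].

Definition tube_point (i : 'I_d) (k l : nat) (g : {ffun 'I_d.-1 -> 'I_k}) : vec :=
  [ffun j => if unlift i j is Some j' then Posz (g j') else Posz l].

Definition tube_layer (c : site) (i : 'I_d) (k l : nat) : {set site} :=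
  [set (c : V) + pr (tube_point i l g) | g : {ffun 'I_d.-1 -> 'I_k}].

Lemma card_tube_seeds c i k : (#|tube_seeds c i k| <= d * k)%N.
Proof.
apply: leq_trans (leq_imset_card _ _) _; apply: leq_trans (max_card _) _.
by rewrite card_prod !card_ord.
Qed.

Lemma card_tube_layer c i k l : (k <= n)%N -> #|tube_layer c i k l| = (k ^ d.-1)%N.
Proof.
move=> kn; rewrite card_imset; first by rewrite card_ffun !card_ord.
move=> g h /addrI /ffunP E; apply/ffunP => j; apply/ord_inj.
have := E (lift i j); rewrite !ffunE liftK => /int_mod_inj.
have := ltn_ord (g j); have := ltn_ord (h j).
move: (nat_of_ord (g j)) (nat_of_ord (h j)) => a b hb ha ab.
have lt : (`|(a%:Z - b%:Z)%R|%N < n)%N by lia.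
by case: (ab lt).
Qed.

Lemma tube_segment X c i k L : closed2 X -> (1 < d)%N -> (0 < k)%N ->
  tube_seeds c i k \subset X ->
  (forall l, (0 < l < L)%N -> exists2 x, x \in tube_layer c i k l & x \in X) ->
  has_segment L X.
Proof.
move=> clX d1 k0 /subsetP seeds layers; apply/has_segmentP; exists c, i.
have sd j (t : nat) : j != i -> (t < k)%N -> pullback X c (0 + axis j t%:Z).
  move=> ji tk; rewrite /pullback add0r; apply: seeds; apply/imsetP.
  by exists (j, Ordinal tk) => //; rewrite inE.
have [j ji] : exists j : 'I_d, j != i.
  have [i0|i0] := eqVneq i (Ordinal d1); last by exists (Ordinal d1); rewrite eq_sym.
  by exists (Ordinal (ltnW d1)); rewrite i0.
apply: (@tube_fills _ _ _ _ k _ (@pullback_closed _ _ X c clX) sd _ k0).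
  by have := sd j 0%N ji k0; rewrite axis0 addr0.
move=> l hl; have [_ /imsetP[g _ ->] xX] := layers l hl.
exists (tube_point i l g); last by rewrite add0r.
split; first by rewrite ffunE unlift_none.
move=> t; rewrite eq_sym => /unlift_some[t' -> E]; rewrite ffunE liftK.
by rewrite le0z_nat ltz_nat ltn_ord.
Qed.

End Growth.

(** * Packings of windows, and translations *)

Section Windows.
Variables d m : nat.
Local Notation n := m.+3.
Local Notation V := {ffun 'I_d -> 'I_m.+3}.
Local Notation site := (torus d m.+3).
Implicit Types (A S T X Y D : {set torus d m.+3}) (a x y z : V).

Lemma card_site : #|{: site}| = (n ^ d)%N.
Proof. by rewrite card_ffun !card_ord. Qed.

(* [D] is the set of centres of a maximal family of disjoint windows. *)
Lemma window_packing r : exists D, [/\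
  {in D &, forall x y, x != y -> [disjoint window r x & window r y]},
  forall x, exists2 c, c \in D & close_to r.*2 x c,
  (n ^ d <= #|D| * r.*2.*2.+1 ^ d)%N &
  ((r < n)%N -> (#|D| * r.+1 ^ d <= n ^ d)%N)].
Proof.
pose P : pred {set site} := fun D => [forall x in D, forall y in D,
  (x != y) ==> [disjoint window r x & window r y]].
have P0 : P set0 by apply/forall_inP => x; rewrite inE.
case: (@arg_maxnP _ set0 P (fun D : {set site} => #|D|) P0) => D PD maxD.
have dis : {in D &, forall x y, x != y -> [disjoint window r x & window r y]}.
  move=> x y xD yD; have /forall_inP/(_ x xD)/forall_inP/(_ y yD)/implyP := PD.
  exact.
(* A site not within [2 r] of any centre could be added as a new centre, against maximality. *)
have cover x : exists2 c, c \in D & close_to r.*2 x c.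
  have [/existsP[c /andP[cD xc]]|] := boolP [exists c : site, (c \in D) && close_to r.*2 x c].
    by exists c.
  rewrite negb_exists => /forallP far.
  have disx c : c \in D -> [disjoint window r x & window r c].
    move=> cD; rewrite -setI_eq0; apply/eqP/setP => y; rewrite !inE.
    apply: contraNF (far c) => /andP[xy cy]; rewrite cD /= -addnn.
    by apply: close_to_trans xy _; exact: close_to_sym.
  have xD : x \notin D.
    by apply: contraNN (far x) => xD; rewrite xD close_to_refl.
  have : P ((x : site) |: D).
    apply/forall_inP => y yD; apply/forall_inP => z zD; apply/implyP.
    move: yD zD; rewrite !inE => /orP[/eqP->|yD] /orP[/eqP->|zD] ne.
    - by rewrite eqxx in ne.
    - exact: disx.
    - by rewrite disjoint_sym; exact: disx.
    - exact: dis.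
  by move/maxD; rewrite cardsU1 xD add1n /= ltnn.
exists D; split => //.
- rewrite -card_site -cardsT.
  have -> : [set: site] = \bigcup_(c in D) window r.*2 c.
    apply/setP => x; rewrite inE; apply/esym/bigcupP.
    by have [c cD xc] := cover x; exists c => //; rewrite inE close_to_sym.
  apply: (@leq_trans (\sum_(c in D) #|window r.*2 c|)).
    apply: (@big_rec2 _ _ (fun (A : {set site}) k => #|A| <= k)%N) => [|c k A _ h].
      by rewrite cards0.
    by apply: leq_trans (leq_card_setU _ _) _; rewrite leq_add2l.
  rewrite -sum_nat_const; apply: leq_sum => c _; exact: card_window_le.
- move=> rn; rewrite -card_site -cardsT -sum_nat_const.
  apply: (@leq_trans (\sum_(c in D) #|window r c|)).
    by apply: leq_sum => c _; exact: card_window_ge.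
  under eq_bigr do rewrite -sum1_card.
  rewrite (exchange_big_dep predT) //= cardsT -sum1_card.
  apply: leq_sum => x _; rewrite sum1_card; apply/card_le1P => c.
  move=> /andP[cD xc] c'; apply/idP/eqP => [/andP[c'D xc']|->]; last exact/andP.
  apply: contraTeq xc => ne.
  by have := dis _ _ c'D cD ne; rewrite disjoint_subset => /subsetP/(_ x xc').
Qed.

Definition shift_set a X : {set site} := [set x : site | (x : V) - a \in X].

Definition shift_config a (w : config d n) : config d n :=
  [ffun x : site => w ((x : V) - a)].

Lemma occupied_shift a w : occupied (shift_config a w) = shift_set a (occupied w).
Proof. by apply/setP => x; rewrite !inE ffunE. Qed.

Lemma shift_setK a X : shift_set (- a) (shift_set a X) = X.
Proof. by apply/setP => x; rewrite !inE opprK addrK. Qed.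

Lemma shift_set_sub a X Y : X \subset Y -> shift_set a X \subset shift_set a Y.
Proof. by move=> /subsetP XY; apply/subsetP => x; rewrite !inE; exact: XY. Qed.

Lemma shift_setI a X Y : shift_set a (X :&: Y) = shift_set a X :&: shift_set a Y.
Proof. by apply/setP => x; rewrite !inE. Qed.

Lemma adj_shift a x y : @adj d n x y -> @adj d n (x + a) (y + a).
Proof.
by move=> /adjP[i [s ->]]; apply/adjP; exists i, s; rewrite addrAC.
Qed.

Lemma closed2_shift a X : closed2 X -> closed2 (shift_set a X).
Proof.
move=> /closed2P clX; apply/closed2P => v u1 u2; rewrite !inE => h1 h2 a1 a2 ne.
apply: (clX _ _ _ h1 h2); [exact: adj_shift|exact: adj_shift|].
by apply: contraNneq ne => /addIr ->.
Qed.

Lemma cl_shift a X : cl (shift_set a X) = shift_set a (cl X).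
Proof.
have sub b Y : cl (shift_set b Y) \subset shift_set b (cl Y).
  by apply: cl_min; [exact/closed2_shift/cl_closed|exact/shift_set_sub/sub_cl].
apply/eqP; rewrite eqEsubset sub /=.
have := shift_set_sub a (sub (- a) (shift_set a X)).
rewrite shift_setK => h; apply: subset_trans h _.
by rewrite -{1}(opprK a) shift_setK.
Qed.

Lemma shift_setT a : shift_set a [set: site] = [set: site].
Proof. by apply/setP => x; rewrite !inE. Qed.

Lemma complete_occupation_shift a (w : config d n) :
  complete_occupation (shift_config a w) = complete_occupation w.
Proof.
rewrite !complete_occupationE occupied_shift cl_shift.
apply/eqP/eqP => [E|->]; last exact: shift_setT.
by rewrite -(shift_setK a (cl _)) E shift_setT.
Qed.

Lemma has_segment_shift a L X : has_segment L (shift_set a X) = has_segment L X.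
Proof.
suff imp b Y : has_segment L Y -> has_segment L (shift_set b Y).
  apply/idP/idP; last exact: imp.
  by move=> /(imp (- a)); rewrite shift_setK.
move=> /has_segmentP[c [i H]]; apply/has_segmentP; exists (c + b), i => k kL.
have := H k kL; rewrite /pullback inE => h.
by rewrite addrAC addrK.
Qed.

Lemma window_shift a r x : window r (x + a) = shift_set a (window r x).
Proof.
apply/setP => y; rewrite !inE; apply/close_toP/close_toP => H i; have [e he] := H i.
  by rewrite !ffunE => E; exists e => //; rewrite E; ring.
by rewrite !ffunE => E; exists e => //; rewrite addrAC -E subrK.
Qed.

(** A local event: only the bits in the window are read, although the closure is taken in the whole
    torus. *)
Definition nucleates (L r : nat) (c : site) (w : config d n) : bool :=
  has_segment L (cl (occupied w :&: window r c)).

Lemma nucleates_shift a L r c w :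
  nucleates L r ((c : V) + a) (shift_config a w) = nucleates L r c w.
Proof.
by rewrite /nucleates occupied_shift window_shift -shift_setI cl_shift has_segment_shift.
Qed.

Lemma flip_shift a (x : site) (w : config d n) :
  flip ((x : V) + a) (shift_config a w) = shift_config a (flip x w).
Proof.
apply/ffunP => y; rewrite !ffunE.
by rewrite -(inj_eq (addIr (- a))) addrK.
Qed.

End Windows.

(** * The product measure *)

Section Expectation.
Variables (R : realType) (V : finType) (p : R).
Hypotheses (p0 : 0 < p) (p1 : p < 1).
Ltac plra := have := p0; have := p1; lra.
Local Notation cfg := {ffun V -> bool}.
Implicit Types (f g h : cfg -> R) (w : cfg) (x y : V) (s : seq V) (A B : {set V}).

Definition weight w : R := \prod_v (if w v then p else 1 - p).

Definition Ex f : R := \sum_w weight w * f w.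

Definition upd x b w : cfg := [ffun v => if v == x then b else w v].

Definition flipv x w : cfg := [ffun v => if v == x then ~~ w v else w v].

(** Conditional expectation given all bits but the one at [x], as an operator on functions. *)
Definition Avg x f : cfg -> R := fun w => p * f (upd x true w) + (1 - p) * f (upd x false w).

Definition Avgs s f : cfg -> R := foldr Avg f s.

Definition depends A f := forall w w', {in A, w =1 w'} -> f w = f w'.

Lemma eq_Ex f g : f =1 g -> Ex f = Ex g.
Proof. by move=> fg; apply: eq_bigr => w _; rewrite fg. Qed.

Lemma weight_ge0 w : 0 <= weight w.
Proof. by apply: prodr_ge0 => v _; case: ifP => _; plra. Qed.

Lemma ExD f g : Ex (fun w => f w + g w) = Ex f + Ex g.
Proof. by rewrite /Ex -big_split; apply: eq_bigr => w _; rewrite mulrDr. Qed.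

Lemma ExZ (c : R) f : Ex (fun w => c * f w) = c * Ex f.
Proof. by rewrite /Ex mulr_sumr; apply: eq_bigr => w _; rewrite mulrCA. Qed.

Lemma ExN f : Ex (fun w => - f w) = - Ex f.
Proof. by rewrite -mulN1r -ExZ; apply: eq_Ex => w; rewrite mulN1r. Qed.

Lemma ExB f g : Ex (fun w => f w - g w) = Ex f - Ex g.
Proof. by rewrite ExD ExN. Qed.

Lemma Ex_sum (I : Type) (r : seq I) (P : pred I) (F : I -> cfg -> R) :
  Ex (fun w => \sum_(i <- r | P i) F i w) = \sum_(i <- r | P i) Ex (F i).
Proof. by rewrite /Ex exchange_big; apply: eq_bigr => w _; rewrite mulr_sumr. Qed.

Lemma Ex_ge0 f : (forall w, 0 <= f w) -> 0 <= Ex f.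
Proof. by move=> f0; apply: sumr_ge0 => w _; rewrite mulr_ge0 ?weight_ge0. Qed.

Lemma Ex_le f g : (forall w, f w <= g w) -> Ex f <= Ex g.
Proof. by move=> fg; apply: ler_sum => w _; rewrite ler_wpM2l ?weight_ge0. Qed.

Lemma Ex_prod (F : V -> bool -> R) :
  Ex (fun w => \prod_v F v (w v)) = \prod_v (p * F v true + (1 - p) * F v false).
Proof.
under [RHS]eq_bigr => v _ do
  rewrite -[_ + _](big_bool _ (fun b => (if b then p else 1 - p) * F v b)).
rewrite bigA_distr_bigA; apply: eq_bigr => w _.
by rewrite /weight -big_split.
Qed.

Lemma Ex_cst (c : R) : Ex (fun=> c) = c.
Proof.
have := Ex_prod (fun _ _ => 1); rewrite [RHS]big1 => [|v _]; last by rewrite !mulr1; lra.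
rewrite (@eq_Ex _ (fun=> 1)) => [E|w]; last exact: big1_eq.
by rewrite -[RHS]mulr1 -E -ExZ; apply: eq_Ex => w; rewrite mulr1.
Qed.

Lemma flipvK x : involutive (flipv x).
Proof. by move=> w; apply/ffunP => v; rewrite !ffunE; case: eqP; rewrite ?negbK. Qed.

Lemma flipv_upd x w : flipv x w = upd x (~~ w x) w.
Proof. by apply/ffunP => v; rewrite !ffunE; case: eqP => [->|]. Qed.

Lemma upd_id x w : upd x (w x) w = w.
Proof. by apply/ffunP => v; rewrite !ffunE; case: eqP => [->|]. Qed.

Lemma upd_upd x b c w : upd x b (upd x c w) = upd x b w.
Proof. by apply/ffunP => v; rewrite !ffunE; case: eqP. Qed.

Lemma upd_comm x y b c w : x != y -> upd x b (upd y c w) = upd y c (upd x b w).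
Proof.
by move=> xy; apply/ffunP => v; rewrite !ffunE; case: eqP => // ->; rewrite (negPf xy).
Qed.

Lemma Ex_Avg x f : Ex (Avg x f) = Ex f.
Proof.
pose nu w := \prod_(v | v != x) (if w v then p else 1 - p).
have wE w : weight w = (if w x then p else 1 - p) * nu w by rewrite /weight (bigD1 x).
have nuf w : nu (flipv x w) = nu w.
  by apply: eq_bigr => v vx; rewrite ffunE (negPf vx).
have fx w : flipv x w x = ~~ w x by rewrite ffunE eqxx.
(* Pairing each configuration with its flip at [x] makes the identity hold term by term. *)
have dbl h : Ex h + Ex h = \sum_w (weight w * h w + weight (flipv x w) * h (flipv x w)).
  by rewrite big_split /=; congr (_ + _); rewrite /Ex (reindex_inj (inv_inj (flipvK x))).
suff : Ex (Avg x f) + Ex (Avg x f) = Ex f + Ex f by lra.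
rewrite !dbl; apply: eq_bigr => w _; rewrite !wE nuf fx /Avg.
rewrite flipv_upd !upd_upd.
have := upd_id x w; case: (w x) => /= <-; rewrite !upd_upd; ring.
Qed.

Lemma Ex_Avgs s f : Ex (Avgs s f) = Ex f.
Proof. by elim: s => //= x s IH; rewrite Ex_Avg. Qed.

Lemma depends_sub A B f : A \subset B -> depends A f -> depends B f.
Proof. by move=> /subsetP AB fA w w' E; apply: fA => v /AB; exact: E. Qed.

Lemma depends_Avgs A s f : depends A f -> depends (A :\: [set v in s]) (Avgs s f).
Proof.
move=> fA; elim: s => [|x s IH].
  by apply: depends_sub fA; apply/subsetP => v; rewrite !inE.
move=> w w' E /=; rewrite /Avg.
by congr (_ * _ + _ * _); apply: IH => v; rewrite !inE => /andP[vs vA];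
  rewrite !ffunE; case: eqP => // /eqP vx; apply: E; rewrite !inE negb_or vx vs vA.
Qed.

Lemma Avg_mulr x f g w : (forall b, g (upd x b w) = g w) ->
  Avg x (fun w => f w * g w) w = Avg x f w * g w.
Proof. by move=> gx; rewrite /Avg !gx; ring. Qed.

Lemma depends_upd B g x b w : depends B g -> x \notin B -> g (upd x b w) = g w.
Proof.
move=> gB xB; apply: gB => v vB; rewrite ffunE; case: eqP => // E.
by rewrite -E vB in xB.
Qed.

Lemma eq_Avg x f g : f =1 g -> Avg x f =1 Avg x g.
Proof. by move=> fg w; rewrite /Avg !fg. Qed.

Lemma Avgs_mulr B s f g : depends B g -> (forall v, v \in s -> v \notin B) ->
  Avgs s (fun w => f w * g w) =1 (fun w => Avgs s f w * g w).
Proof.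
move=> gB; elim: s => //= x s IH sB w.
rewrite (eq_Avg x (IH _)); last by move=> v vs; apply: sB; rewrite inE vs orbT.
by rewrite Avg_mulr // => b; apply: depends_upd gB _; apply: sB; rewrite inE eqxx.
Qed.

Lemma Avgs_all A f w : depends A f -> Avgs (enum A) f w = Ex f.
Proof.
move=> fA; rewrite -(Ex_Avgs (enum A)) -[LHS]Ex_cst; apply: eq_Ex => w'.
by apply: (depends_Avgs fA) => v; rewrite !inE mem_enum; case: (v \in A).
Qed.

(** Averaging over the sites of [A] leaves [g] untouched and turns [f] into the constant [Ex f]. *)
Lemma Ex_indep A B f g : depends A f -> depends B g -> [disjoint A & B] ->
  Ex (fun w => f w * g w) = Ex f * Ex g.
Proof.
move=> fA gB dis; rewrite -(Ex_Avgs (enum A)).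
rewrite (eq_Ex (@Avgs_mulr B (enum A) f g gB _)) => [|v]; last first.
  by rewrite mem_enum => vA; rewrite (disjointFr dis vA).
by rewrite -ExZ; apply: eq_Ex => w; rewrite (Avgs_all w fA).
Qed.

Lemma Ex_reindex (h h' : V -> V) f : cancel h h' -> cancel h' h ->
  Ex (fun w => f [ffun v => w (h v)]) = Ex f.
Proof.
move=> hK h'K; rewrite [RHS](reindex (fun w => [ffun v => w (h v)] : cfg)) /=.
  apply: eq_bigr => w _; congr (_ * _).
  rewrite /weight [LHS](reindex h) /=; last by exists h' => v _.
  by apply: eq_bigr => v _; rewrite ffunE.
by exists (fun w => [ffun v => w (h' v)]) => w _; apply/ffunP => v;
  rewrite !ffunE ?hK ?h'K.
Qed.

Definition Prob (E : pred cfg) : R := Ex (fun w => (E w)%:R).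

Lemma eq_Prob (E F : pred cfg) : E =1 F -> Prob E = Prob F.
Proof. by move=> EF; apply: eq_Ex => w; rewrite EF. Qed.

Lemma Prob_ge0 (E : pred cfg) : 0 <= Prob E.
Proof. by apply: Ex_ge0 => w; rewrite ler0n. Qed.

Lemma Prob_le (E F : pred cfg) : (forall w, E w -> F w) -> Prob E <= Prob F.
Proof.
move=> EF; apply: Ex_le => w; have := EF w.
by case: (E w) => [->|] //; rewrite ler0n.
Qed.

Lemma Prob_le1 (E : pred cfg) : Prob E <= 1.
Proof. by rewrite -[leRHS]Ex_cst; apply: Ex_le => w; case: (E w). Qed.

Lemma ProbC (E : pred cfg) : Prob (fun w => ~~ E w) = 1 - Prob E.
Proof.
rewrite -[X in X - _]Ex_cst -ExB; apply: eq_Ex => w.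
by case: (E w); rewrite ?subrr ?subr0.
Qed.

Lemma Prob_exists (I : finType) (Q : pred I) (E : I -> pred cfg) :
  Prob (fun w => [exists i, Q i && E i w]) <= \sum_(i | Q i) Prob (E i).
Proof.
rewrite -Ex_sum; apply: Ex_le => w.
case: existsP => [[i /andP[Qi Ei]]|_]; last by apply: sumr_ge0 => i _; rewrite ler0n.
by rewrite (bigD1 i) //= Ei lerDl sumr_ge0 // => j _; rewrite ler0n.
Qed.

Lemma ProbU (E F : pred cfg) : Prob (fun w => E w || F w) <= Prob E + Prob F.
Proof.
rewrite -ExD; apply: Ex_le => w.
by case: (E w); case: (F w) => /=; rewrite ?addr0 ?add0r // lerDl.
Qed.

Lemma Prob_all_true A : Prob (fun w => [forall v in A, w v]) = p ^+ #|A|.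
Proof.
pose F v (b : bool) : R := if v \in A then b%:R else 1.
rewrite /Prob (@eq_Ex _ (fun w => \prod_v F v (w v))) => [|w].
  rewrite Ex_prod -sum1_card -prodrXr [RHS]big_mkcond /=.
  by apply: eq_bigr => v _; rewrite /F; case: ifP => _; rewrite ?expr1 /=; lra.
case: forall_inP => [H|H].
  by rewrite big1 // => v _; rewrite /F; case: ifP => // /H ->.
have [v vA nv] : exists2 v, v \in A & ~~ w v.
  apply: contra_notP H => H v vA; apply: contra_notT H => nv; by exists v.
by rewrite (bigD1 v) //= /F vA (negPf nv) mul0r.
Qed.

Lemma Prob_all_false A : Prob (fun w => [forall v in A, ~~ w v]) = (1 - p) ^+ #|A|.
Proof.
pose F v (b : bool) : R := if v \in A then (~~ b)%:R else 1.
rewrite /Prob (@eq_Ex _ (fun w => \prod_v F v (w v))) => [|w].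
  rewrite Ex_prod -sum1_card -prodrXr [RHS]big_mkcond /=.
  by apply: eq_bigr => v _; rewrite /F; case: ifP => _; rewrite ?expr1 /=; lra.
case: forall_inP => [H|H].
  by rewrite big1 // => v _; rewrite /F; case: ifP => // /H ->.
have [v vA nv] : exists2 v, v \in A & w v.
  apply: contra_notP H => H v vA; apply/negP => nv; apply: H; by exists v.
by rewrite (bigD1 v) //= /F vA nv mul0r.
Qed.

Definition count_in A w : R := \sum_(v in A) (w v)%:R.

Lemma mgf A (l : R) :
  Ex (fun w => expR (l * count_in A w)) <= expR (p * #|A|%:R * (expR l - 1)).
Proof.
pose F v (b : bool) : R := if v \in A then expR (l * b%:R) else 1.
rewrite (@eq_Ex _ (fun w => \prod_v F v (w v))) => [|w]; last first.
  rewrite /count_in mulr_sumr expR_sum big_mkcond /=.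
  by apply: eq_bigr => v _; rewrite /F; case: ifP.
rewrite Ex_prod mulrAC -[#|A|%:R]/(1 *+ _) -sumr_const mulr_sumr expR_sum.
rewrite [leRHS]big_mkcond /=; apply: ler_prod => v _; rewrite /F.
case: ifP => _; last by apply/andP; split; plra.
rewrite mulr1 mulr0 expR0; have := expR_gt0 l; have := expR_ge1Dx (p * (expR l - 1)).
move=> h1 h2; rewrite !mulr1; apply/andP; split; last by apply: le_trans h1; plra.
by rewrite addr_ge0 ?mulr_ge0 //; plra.
Qed.

Definition increasing (E : pred cfg) :=
  forall w w', (forall v, w v -> w' v) -> E w -> E w'.

(** The local form of Russo's formula: given the other bits, both sides vanish unless the bit at [x]
    decides [E], and then the right side averages to [p (1 - p)]. *)
Lemma Prob_pivotal (E : pred cfg) x : increasing E ->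
  p * (1 - p) * Prob (fun w => E w != E (flipv x w)) =
  Ex (fun w => ((w x)%:R - p) * (E w)%:R).
Proof.
move=> incE; rewrite /Prob -(Ex_Avg x) -ExZ -[RHS](Ex_Avg x).
apply: eq_Ex => w; rewrite /Avg !flipv_upd !ffunE eqxx /= !upd_upd.
have : E (upd x false w) -> E (upd x true w).
  by apply: incE => v; rewrite !ffunE; case: eqP.
by case: (E (upd x false w)) => [->//|_]; case: (E (upd x true w)) => /=; ring.
Qed.

End Expectation.

(** * The Falik-Samorodnitsky inequality *)

Section TwoPoint.
Variable R : realType.
Implicit Types a b c m x : R.

Lemma ln_leB1 x : 0 < x -> ln x <= x - 1.
Proof. by move=> x0; rewrite -{1}(subrKC 1 x); apply: le_ln1Dx; lra. Qed.

Lemma gibbs_term a a0 m m0 : 0 <= a -> 0 <= a0 -> 0 <= m -> 0 <= m0 ->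
  (0 < a -> [/\ 0 < m, 0 < a0 & 0 < m0]) ->
  a - m * a0 / m0 <= a * (ln a - ln m - (ln a0 - ln m0)).
Proof.
move=> a_ge0 a00 m_ge0 m00 pos; have [a_gt0|] := ltP 0 a; last first.
  move=> ale0; have -> : a = 0 by lra.
  by rewrite mul0r sub0r oppr_le0 divr_ge0 // mulr_ge0.
have [m_gt0 a0_gt0 m0_gt0] := pos a_gt0.
have h : 0 < m * a0 by rewrite mulr_gt0.
have h' : 0 < m * a0 / m0 by rewrite divr_gt0.
have := ln_leB1 (divr_gt0 h' a_gt0).
have -> : ln (m * a0 / m0 / a) = ln m + ln a0 - ln m0 - ln a.
  by rewrite !ln_div ?posrE // lnM ?posrE.
move=> le.
have -> : a - m * a0 / m0 = a * (1 - m * a0 / m0 / a) by field; rewrite !gt_eqF.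
by rewrite ler_pM2l //; lra.
Qed.

Lemma sqr_le4B a b : 4 * b ^+ 2 <= a ^+ 2 -> a ^+ 2 <= 4 * (a - b) ^+ 2.
Proof. by move=> h; have h2 := sqr_ge0 (a - 2 * b); nra. Qed.

Definition xlnx x := x * ln x.

Variable p : R.
Hypotheses (p0 : 0 < p) (p1 : p < 1).

Definition ent2 a b := p * xlnx a + (1 - p) * xlnx b - xlnx (p * a + (1 - p) * b).

(** Gibbs' variational principle on two points, with competitor [a0], [b0] and equality when it is
    [a], [b]. The vanishing hypotheses are absolute continuity, which guards against the default
    value of [ln] at 0. *)
Lemma ent2_gibbs a b a0 b0 : 0 <= a -> 0 <= b -> 0 <= a0 -> 0 <= b0 ->
  (a0 = 0 -> a = 0) -> (b0 = 0 -> b = 0) ->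
  p * (a * (ln a0 - ln (p * a0 + (1 - p) * b0))) +
    (1 - p) * (b * (ln b0 - ln (p * a0 + (1 - p) * b0))) <= ent2 a b.
Proof.
move=> a_ge0 b_ge0 a00 b00 az bz; set m0 := p * a0 + (1 - p) * b0.
have q0 : 0 < 1 - p by rewrite subr_gt0.
pose m := p * a + (1 - p) * b.
have pa : 0 <= p * a by rewrite mulr_ge0 // ltW.
have qb : 0 <= (1 - p) * b by rewrite mulr_ge0 // ltW.
have pa0 : 0 <= p * a0 by rewrite mulr_ge0 // ltW.
have qb0 : 0 <= (1 - p) * b0 by rewrite mulr_ge0 // ltW.
have ga : a - m * a0 / m0 <= a * (ln a - ln m - (ln a0 - ln m0)).
  apply: gibbs_term => //; rewrite ?addr_ge0 // => a_gt0.
  have h : 0 < a0 by rewrite lt_def a00 andbT; apply: contraTneq a_gt0 => /az ->; rewrite ltxx.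
  split => //; first by rewrite ltr_wpDr // mulr_gt0.
  by rewrite ltr_wpDr // mulr_gt0.
have gb : b - m * b0 / m0 <= b * (ln b - ln m - (ln b0 - ln m0)).
  apply: gibbs_term => //; rewrite ?addr_ge0 // => b_gt0.
  have h : 0 < b0 by rewrite lt_def b00 andbT; apply: contraTneq b_gt0 => /bz ->; rewrite ltxx.
  split => //; first by rewrite ltr_wpDl // mulr_gt0.
  by rewrite ltr_wpDl // mulr_gt0.
have ga' := ler_wpM2l (ltW p0) ga; have gb' := ler_wpM2l (ltW q0) gb.
(* The sum is [m - m (m0 / m0)]: zero if [m0] is nonzero, and [m] if [m0 = 0], since division by
   zero gives 0. *)
have tot : 0 <= p * (a - m * a0 / m0) + (1 - p) * (b - m * b0 / m0).
  have -> : p * (a - m * a0 / m0) + (1 - p) * (b - m * b0 / m0) = m - m * (m0 / m0).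
    by rewrite /m /m0; ring.
  have [z|nz] := eqVneq m0 0; first by rewrite z mul0r mulr0 subr0 addr_ge0.
  by rewrite divff // mulr1 subrr.
have E : m * ln m = p * (a * ln m) + (1 - p) * (b * ln m) by rewrite {1}/m; ring.
rewrite /ent2 /xlnx -/m E; move: ga' gb' tot.
by move: (ln m) (ln m0) (m * a0 / m0) (m * b0 / m0) => lm lm0 t1 t2; lra.
Qed.

Lemma xlnx_le_sqr x m : 0 <= x -> 0 < m -> x * (ln x - ln m) <= x * (x / m - 1).
Proof.
move=> x_ge0 m0; have [x0|x0] := ltP 0 x; last first.
  have -> : x = 0 by lra.
  by rewrite !mul0r.
rewrite ler_pM2l // -ln_div ?posrE //; apply: ln_leB1; exact: divr_gt0.
Qed.

(* Either [a] and [b] are comparable and the entropy is at most the chi-square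
   divergence, or the value [a] taken with small probability dominates. *)
Lemma log_sobolev2 a b : p <= 1 / 2 ->
  ent2 (a ^+ 2) (b ^+ 2) <= (18 - 8 * ln p) * (p * (1 - p) * (a - b) ^+ 2).
Proof.
move=> ph; have q0 : 0 < 1 - p by rewrite subr_gt0.
have lnp : ln p <= 0 by have := ln_leB1 p0; lra.
have pq : 0 <= p * (1 - p) * (a - b) ^+ 2 by rewrite mulr_ge0 ?sqr_ge0 // mulr_ge0 // ltW.
have split_c : (18 - 8 * ln p) * (p * (1 - p) * (a - b) ^+ 2) =
    18 * (p * (1 - p) * (a - b) ^+ 2) + (- ln p) * (8 * (p * (1 - p) * (a - b) ^+ 2)).
  by ring.
have nl : 0 <= - ln p by lra.
pose m := p * a ^+ 2 + (1 - p) * b ^+ 2.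
have a2 := sqr_ge0 a; have b2 := sqr_ge0 b.
have entE : ent2 (a ^+ 2) (b ^+ 2) =
    p * (a ^+ 2 * (ln (a ^+ 2) - ln m)) + (1 - p) * (b ^+ 2 * (ln (b ^+ 2) - ln m)).
  by rewrite /ent2 /xlnx -/m /m; ring.
(* In the first case [(a + b)^2 <= 9 b^2] and [m >= b^2 / 2], whence 18. In the second
   [a^2 <= 4 (a - b)^2], which [1 - p >= 1/2] turns into 8, and [p a^2 <= m] bounds the logarithm by
   [- ln p]. *)
have [cmp|cmp] := leP (a ^+ 2) (4 * b ^+ 2).
  have [bz|bnz] := eqVneq b 0.
    have az : a = 0 by apply/eqP; rewrite -sqrf_eq0 eq_le a2 andbT; move: cmp; rewrite bz; lra.
    by rewrite az bz subrr expr0n /= /ent2 /xlnx !(mulr0, mul0r, addr0, subr0).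
  have b2p : 0 < b ^+ 2 by rewrite exprn_even_gt0.
  have m0 : 0 < m by apply: ltr_wpDl; [rewrite mulr_ge0 // ltW|rewrite mulr_gt0].
  have ha := ler_wpM2l (ltW p0) (xlnx_le_sqr a2 m0).
  have hb := ler_wpM2l (ltW q0) (xlnx_le_sqr b2 m0).
  apply: (@le_trans _ _ (18 * (p * (1 - p) * (a - b) ^+ 2))); last first.
    by rewrite split_c lerDl mulr_ge0 // mulr_ge0.
  rewrite entE; apply: le_trans (lerD ha hb) _.
  have -> : p * (a ^+ 2 * (a ^+ 2 / m - 1)) + (1 - p) * (b ^+ 2 * (b ^+ 2 / m - 1)) =
      (p * (1 - p) * (a - b) ^+ 2) * ((a + b) ^+ 2 / m).
    by rewrite /m in m0 *; field; rewrite gt_eqF.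
  rewrite mulrC ler_wpM2r //.
  rewrite ler_pdivrMr //.
  have h1 : (a + b) ^+ 2 <= 9 * b ^+ 2.
    by have := sqr_ge0 (a - 2 * b); lra.
  have h2 : 1 / 2 * b ^+ 2 <= m.
    have : 0 <= (1 / 2 - p) * b ^+ 2 by rewrite mulr_ge0 // subr_ge0.
    have : 0 <= p * a ^+ 2 by rewrite mulr_ge0 // ltW.
    by rewrite /m; lra.
  by lra.
apply: (@le_trans _ _ ((- ln p) * (8 * (p * (1 - p) * (a - b) ^+ 2)))); last first.
  by rewrite split_c lerDr mulr_ge0.
have a2p : 0 < a ^+ 2 by lra.
have bm : b ^+ 2 <= m.
  have : 0 <= p * (a ^+ 2 - b ^+ 2) by rewrite mulr_ge0 ?(ltW p0) //; lra.
  by rewrite /m; lra.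
have am : p * a ^+ 2 <= m by rewrite /m lerDl mulr_ge0 // ltW.
have m0 : 0 < m by apply: lt_le_trans am; rewrite mulr_gt0.
have hb : (1 - p) * (b ^+ 2 * (ln (b ^+ 2) - ln m)) <= 0.
  apply: mulr_ge0_le0; first exact: ltW.
  have [bz|bz] := eqVneq (b ^+ 2) 0; first by rewrite bz mul0r.
  by apply: mulr_ge0_le0 => //; rewrite subr_le0 ler_ln ?posrE // lt_def bz.
have ha : a ^+ 2 * (ln (a ^+ 2) - ln m) <= a ^+ 2 * (- ln p).
  rewrite ler_pM2l //.
  have : ln (p * a ^+ 2) <= ln m by rewrite ler_ln ?posrE // mulr_gt0.
  by rewrite lnM ?posrE //; lra.
rewrite entE; have ha' := ler_wpM2l (ltW p0) ha.
have h4 := sqr_le4B (ltW cmp).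
have h5 : p * a ^+ 2 <= 8 * (p * (1 - p) * (a - b) ^+ 2).
  have : p * a ^+ 2 <= p * (4 * (a - b) ^+ 2) by rewrite ler_wpM2l // ltW.
  have : 0 <= (1 - 2 * p) * (p * (a - b) ^+ 2).
    by apply: mulr_ge0; [lra|apply: mulr_ge0; [exact: ltW|exact: sqr_ge0]].
  by set t := (a - b) ^+ 2; lra.
have := ler_wpM2l nl h5; lra.
Qed.

End TwoPoint.

Section FalikSamorodnitsky.
Variables (R : realType) (V : finType) (p : R).
Hypotheses (p0 : 0 < p) (p1 : p < 1).
Local Notation cfg := {ffun V -> bool}.
Local Notation Ex := (@Ex R V p).
Local Notation Avg := (@Avg R V p).
Local Notation Avgs := (@Avgs R V p).
Implicit Types (f g h X Y : cfg -> R) (w : cfg) (x y : V) (s : seq V).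

Definition Diff x f : cfg -> R := fun w => f w - Avg x f w.

Let q0 : 0 < 1 - p. Proof. by rewrite subr_gt0. Qed.

Lemma AvgB x f g : Avg x (fun w => f w - g w) = (fun w => Avg x f w - Avg x g w).
Proof. by apply/funext => w; rewrite /Avg; ring. Qed.

Lemma AvgC x y f : Avg x (Avg y f) = Avg y (Avg x f).
Proof.
have [->//|xy] := eqVneq x y; apply/funext => w; rewrite /Avg.
by rewrite !(upd_comm _ _ w xy); ring.
Qed.

Lemma Diff_Avg x y f : Diff x (Avg y f) = Avg y (Diff x f).
Proof. by rewrite /Diff AvgB AvgC. Qed.

Lemma Diff_Avgs x s f : Diff x (Avgs s f) = Avgs s (Diff x f).
Proof. by elim: s => //= y s IH; rewrite Diff_Avg IH. Qed.

Lemma DiffC x y f : Diff x (Diff y f) = Diff y (Diff x f).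
Proof.
by apply/funext => w; rewrite /Diff !AvgB AvgC; ring.
Qed.

Lemma Avg_ge0 x f : (forall w, 0 <= f w) -> forall w, 0 <= Avg x f w.
Proof. by move=> f0 w; rewrite addr_ge0 // mulr_ge0 // ltW. Qed.

Lemma Avg_le x f g : (forall w, f w <= g w) -> forall w, Avg x f w <= Avg x g w.
Proof. by move=> fg w; rewrite lerD // ler_wpM2l // ltW. Qed.

Lemma Avgs_ge0 s f : (forall w, 0 <= f w) -> forall w, 0 <= Avgs s f w.
Proof. by move=> f0; elim: s => //= x s IH; exact: Avg_ge0. Qed.

Lemma Avg_norm x f w : `|Avg x f w| <= Avg x (fun w => `|f w|) w.
Proof.
apply: le_trans (ler_normD _ _) _.
by rewrite !normrM (gtr0_norm p0) (gtr0_norm q0).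
Qed.

Lemma Avgs_norm s f w : `|Avgs s f w| <= Avgs s (fun w => `|f w|) w.
Proof.
elim: s w => //= x s IH w; apply: le_trans (Avg_norm _ _ _) _.
by apply: Avg_le.
Qed.

Lemma Avgs_all_sites f w : Avgs (enum V) f w = Ex f.
Proof.
have -> : enum V = enum [set: V] by apply: eq_enum => v; rewrite !inE.
by apply: Avgs_all => // a b ab; congr f; apply/ffunP => v; apply: ab; rewrite inE.
Qed.

Lemma Avg_upd x b f w : Avg x f (upd x b w) = Avg x f w.
Proof. by rewrite /Avg !upd_upd. Qed.

Definition ent_at x X : cfg -> R :=
  fun w => ent2 p (X (upd x true w)) (X (upd x false w)).

Definition Ent X := Ex (fun w => xlnx (X w)) - xlnx (Ex X).

Lemma Avgs_eq0 s X w : (forall w, 0 <= X w) -> Avgs s X w = 0 -> X w = 0.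
Proof.
move=> X0; elim: s w => //= x s IH w.
move=> /eqP; rewrite /Avg paddr_eq0; last 2 first.
- by rewrite mulr_ge0 ?(ltW p0) // Avgs_ge0.
- by rewrite mulr_ge0 ?(ltW q0) // Avgs_ge0.
rewrite !mulf_eq0 (gt_eqF p0) (gt_eqF q0) /= => /andP[/eqP h1 /eqP h2].
by apply: IH; rewrite -(upd_id x w); case: (w x).
Qed.

(* Telescoping over the sites, each increment being bounded by Gibbs' variational
   principle. *)
Lemma entropy_subadditive X : (forall w, 0 <= X w) ->
  Ent X <= \sum_y Ex (ent_at y X).
Proof.
move=> X0.
(* With [s] empty the left side is 0; with all sites in [s] it is [Ent X]. *)
suff H s : Ex (fun w => xlnx (X w)) - Ex (fun w => X w * ln (Avgs s X w)) <=
    \sum_(y <- s) Ex (ent_at y X).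
  have := H (enum V); rewrite big_enum; apply: le_trans.
  rewrite /Ent lerD2l lerN2.
  rewrite le_eqVlt; apply/orP; left; apply/eqP; rewrite /xlnx mulrC -ExZ.
  by apply: eq_Ex => w; rewrite Avgs_all_sites mulrC.
elim: s => [|y s IH]; first by rewrite big_nil /= subrr.
rewrite big_cons /=; set Y := Avgs s X.
have Y0 := Avgs_ge0 s X0.
have -> : Ex (fun w => xlnx (X w)) - Ex (fun w => X w * ln (Avg y Y w)) =
   Ex (fun w => X w * (ln (Y w) - ln (Avg y Y w))) +
   (Ex (fun w => xlnx (X w)) - Ex (fun w => X w * ln (Y w))).
  rewrite -[LHS]ExB -ExB -ExD; apply: eq_Ex => w; ring.
rewrite lerD // -(Ex_Avg p y); apply: Ex_le => // w.
rewrite {1}/Avg !Avg_upd.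
by apply: ent2_gibbs => //; try exact: Y0; move=> /(Avgs_eq0 X0).
Qed.

Lemma Avg_sqr_Diff y g w : Avg y (fun w => Diff y g w ^+ 2) w =
  p * (1 - p) * (g (upd y true w) - g (upd y false w)) ^+ 2.
Proof. by rewrite /Diff {1}/Avg !Avg_upd /Avg; ring. Qed.

Definition log_sobolev_const := 18 - 8 * ln p.

Lemma log_sobolev g : p <= 1 / 2 ->
  Ent (fun w => g w ^+ 2) <= log_sobolev_const * \sum_y Ex (fun w => Diff y g w ^+ 2).
Proof.
move=> ph; apply: le_trans (entropy_subadditive _) _ => [w|]; first exact: sqr_ge0.
rewrite mulr_sumr; apply: ler_sum => y _.
rewrite -(Ex_Avg p y (fun w => Diff y g w ^+ 2)) -ExZ; apply: Ex_le => // w.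
by rewrite Avg_sqr_Diff; exact: log_sobolev2.
Qed.

(** Optimised over [k] this is the bound [B ln (B / A^2)], with [B] the second moment and [A] the
    first absolute moment. In its linear form it can be summed over martingale differences
    directly. *)
Lemma entropy_sqr_ge g k : 0 < k ->
  Ex (fun w => g w ^+ 2) * (ln k + 1) - k * Ex (fun w => `|g w|) ^+ 2
    <= Ent (fun w => g w ^+ 2).
Proof.
move=> k0; set B := Ex (fun w => g w ^+ 2); set A := Ex (fun w => `|g w|).
have B0 : 0 <= B by apply: Ex_ge0 => // w; exact: sqr_ge0.
have A0 : 0 <= A by apply: Ex_ge0.
have low c : 0 < c ->
    2 * (1 + ln c) * B - 2 * c * A - xlnx B <= Ent (fun w => g w ^+ 2).
  move=> c0; rewrite /Ent -/B lerD2r -!ExZ -ExB; apply: Ex_le => // w.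
  have -> : g w ^+ 2 = `|g w| ^+ 2 by rewrite real_normK // num_real.
  move: (`|g w|) (normr_ge0 (g w)) => t t0; rewrite /xlnx.
  have [tz|tnz] := eqVneq t 0; first by rewrite tz expr0n /= !(mulr0, mul0r, subr0).
  have tp : 0 < t by rewrite lt_def tnz.
  rewrite lnXn // -mulr_natl.
  have := ln_leB1 (divr_gt0 c0 tp); rewrite ln_div ?posrE // => h.
  have := ler_wpM2l (sqr_ge0 t) h.
  have -> : t ^+ 2 * (c / t - 1) = c * t - t ^+ 2 by field.
  by move: (ln c) (ln t) => lc lt; lra.
have [Bz|Bnz] := eqVneq B 0.
  rewrite Bz mul0r sub0r.
  have [Az|Anz] := eqVneq A 0.
    rewrite Az expr0n /= mulr0 oppr0; apply: le_trans (low 1 ltr01).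
    by rewrite Az Bz /xlnx !(mulr0, mul0r, subr0).
  have Ap : 0 < A by rewrite lt_def Anz.
  (* With [B = 0] the bound [low c] reads [- 2 c A], which is [- k A^2] for this [c]. *)
  have c0 : 0 < k * A / 2 by rewrite divr_gt0 // mulr_gt0.
  apply: le_trans (low _ c0).
  rewrite Bz /xlnx !(mulr0, mul0r, subr0) sub0r lerN2.
  by rewrite le_eqVlt; apply/orP; left; apply/eqP; field.
have Bp : 0 < B by rewrite lt_def Bnz.
have kB : 0 < k * B by rewrite mulr_gt0.
(* This [c] turns [B + k A^2 - 2 c A] into the square [(c - k A)^2 / k]. *)
pose c := Num.sqrt (k * B).
have c0 : 0 < c by rewrite sqrtr_gt0.
have c2 : c ^+ 2 = k * B by rewrite sqr_sqrtr // ltW.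
apply: le_trans (low c c0).
have lnc : 2 * ln c = ln k + ln B.
  by rewrite -lnM ?posrE // -c2 lnXn // mulr_natl.
have sq : 0 <= B + k * A ^+ 2 - 2 * c * A.
  have h : k * (B + k * A ^+ 2 - 2 * c * A) = (c - k * A) ^+ 2.
    by rewrite sqrrB c2; ring.
  by rewrite -(pmulr_rge0 _ k0) h sqr_ge0.
rewrite /xlnx; have -> : 2 * (1 + ln c) * B = 2 * B + (2 * ln c) * B by ring.
by rewrite lnc; move: sq; move: (ln k) (ln B) => lk lB; lra.
Qed.

Lemma Ex_sqr_Avg x g :
  Ex (fun w => Diff x g w ^+ 2) = Ex (fun w => g w ^+ 2) - Ex (fun w => Avg x g w ^+ 2).
Proof.
rewrite -ExB -(Ex_Avg p x) -[RHS](Ex_Avg p x); apply: eq_Ex => w.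
by rewrite Avg_sqr_Diff {1}/Avg !Avg_upd /Avg; ring.
Qed.

Definition variance f := Ex (fun w => f w ^+ 2) - Ex f ^+ 2.

(* Average out the sites one at a time and apply the logarithmic Sobolev inequality
   to each martingale difference. *)
Theorem falik_samorodnitsky f k : p <= 1 / 2 -> 0 < k ->
  variance f * (ln k + 1) - k * \sum_x Ex (fun w => `|Diff x f w|) ^+ 2
    <= log_sobolev_const * \sum_x Ex (fun w => Diff x f w ^+ 2).
Proof.
move=> ph k0.
(* The list [s] holds the sites averaged out so far. For all sites the first factor is the variance,
   and the subtracted terms on the right vanish because [Diff y f] has mean 0. *)
have main s : (Ex (fun w => f w ^+ 2) - Ex (fun w => Avgs s f w ^+ 2)) * (ln k + 1)
    - k * \sum_(x <- s) Ex (fun w => `|Diff x f w|) ^+ 2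
    <= log_sobolev_const * \sum_y (Ex (fun w => Diff y f w ^+ 2)
                      - Ex (fun w => Avgs s (Diff y f) w ^+ 2)).
  elim: s => [|x s IH].
    rewrite big_nil /= subrr mul0r mulr0 subr0 big1 ?mulr0 // => y _.
    exact: subrr.
  set g := Avgs s f.
  have h1 := log_sobolev (Diff x g) ph.
  have h2 := le_trans (entropy_sqr_ge (Diff x g) k0) h1.
  (* Averaging contracts the first absolute moment, so the martingale difference is controlled by
     the influence of [x] on [f] itself. *)
  have hA : Ex (fun w => `|Diff x g w|) <= Ex (fun w => `|Diff x f w|).
    rewrite -[leRHS](Ex_Avgs p s); apply: Ex_le => // w.
    by rewrite Diff_Avgs; exact: Avgs_norm.
  have hA2 : k * Ex (fun w => `|Diff x g w|) ^+ 2 <= k * Ex (fun w => `|Diff x f w|) ^+ 2.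
    rewrite ler_pM2l // lerXn2r ?nnegrE //; apply: Ex_ge0 => //.
  (* Commuting the two differences and applying Pythagoras at [x] makes the right side telescope
     along [s]. *)
  have hD : \sum_y Ex (fun w => Diff y (Diff x g) w ^+ 2) =
      \sum_y (Ex (fun w => Avgs s (Diff y f) w ^+ 2)
               - Ex (fun w => Avgs (x :: s) (Diff y f) w ^+ 2)).
    by apply: eq_bigr => y _; rewrite DiffC Diff_Avgs Ex_sqr_Avg.
  rewrite hD (Ex_sqr_Avg x g) in h2.
  have -> : \sum_y (Ex (fun w => Diff y f w ^+ 2) - Ex (fun w => Avgs (x :: s) (Diff y f) w ^+ 2))
     = \sum_y (Ex (fun w => Diff y f w ^+ 2) - Ex (fun w => Avgs s (Diff y f) w ^+ 2))
     + \sum_y (Ex (fun w => Avgs s (Diff y f) w ^+ 2)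
               - Ex (fun w => Avgs (x :: s) (Diff y f) w ^+ 2)).
    by rewrite -big_split /=; apply: eq_bigr => y _; ring.
  rewrite [leRHS]mulrDr big_cons; apply: le_trans (lerD IH h2).
  rewrite -/g /= in IH h2 hA2 *; rewrite (mulrDr k); move: hA2.
  move: (Ex (fun w => `|Diff x g w|)) (Ex (fun w => `|Diff x f w|)) => a b.
  move: (Ex (fun w => Avg x g w ^+ 2)) (Ex (fun w => g w ^+ 2)) => c e.
  move: (\sum_(j <- s) _) (ln k) (Ex (fun w => f w ^+ 2)) => t l v.
  by move: (k * a ^+ 2) (k * b ^+ 2) => ka kb; lra.
have := main (enum V).
have -> : Ex (fun w => Avgs (enum V) f w ^+ 2) = Ex f ^+ 2.
  rewrite -[RHS](Ex_cst V p); apply: eq_Ex => w; by rewrite Avgs_all_sites.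
rewrite big_enum; under [X in _ <= _ * X]eq_bigr => y _.
  have -> : Ex (fun w => Avgs (enum V) (Diff y f) w ^+ 2) = 0.
    rewrite -[RHS](Ex_cst V p); apply: eq_Ex => w.
    by rewrite Avgs_all_sites /Diff ExB Ex_Avg subrr expr0n.
  rewrite subr0; over.
by [].
Qed.

End FalikSamorodnitsky.

(** * Rare local events *)

Lemma expR_le_quad (R : realType) (l : R) : 0 <= l -> l <= 1 ->
  expR l <= 1 + l + 2 * l ^+ 2.
Proof.
move=> l0 l1; have h := expR_ge1Dx (- (l / 2)).
have e2 : expR l = (expR (- (l / 2)) ^+ 2)^-1.
  by rewrite -expRM_natl -expRN; congr expR; field.
have y0 : 0 < 1 + - (l / 2) by lra.
rewrite e2 invf_ple ?posrE ?exprn_gt0 ?expR_gt0 //; last by have := sqr_ge0 l; lra.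
apply: (@le_trans _ _ ((1 + - (l / 2)) ^+ 2)); last first.
  by rewrite lerXn2r // ?nnegrE ?expR_ge0 // ltW.
rewrite -[leLHS]mul1r ler_pdivrMr; last by have := sqr_ge0 l; lra.
rewrite -subr_ge0.
have -> : (1 + - (l / 2)) ^+ 2 * (1 + l + 2 * l ^+ 2) - 1 =
  l ^+ 2 * ((1 - l) * (5 / 4 - l / 2)) by field.
by rewrite mulr_ge0 ?sqr_ge0 // mulr_ge0; lra.
Qed.

Section Generic.
Variables (R : realType) (V : finType) (p : R).
Hypotheses (p0 : 0 < p) (p1 : p < 1).
Local Notation cfg := {ffun V -> bool}.
Implicit Types (w : cfg).

Definition piv (E : pred cfg) (x : V) : pred cfg := fun w => E w != E (flipv x w).

Lemma sqr_Diff_indicator (E : pred cfg) x w :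
  ((E (upd x true w))%:R - (E (upd x false w))%:R : R) ^+ 2 = (piv E x w)%:R.
Proof.
rewrite /piv flipv_upd -{3}(upd_id x w).
by case: (w x); case: (E (upd x true w)); case: (E (upd x false w)) => /=;
   rewrite ?subrr ?subr0 ?sub0r ?sqrrN ?expr1n ?expr0n.
Qed.

Lemma Ex_piv_Diff (E : pred cfg) x :
  Ex p (fun w => Diff p x (fun w => (E w)%:R) w ^+ 2) = p * (1 - p) * Prob p (piv E x).
Proof.
rewrite -(Ex_Avg p x) -ExZ; apply: eq_Ex => w.
by rewrite Avg_sqr_Diff sqr_Diff_indicator.
Qed.

(** At a pivotal site the deviation from the mean is [1 - p] with probability [p] and [p] with
    probability [1 - p], hence the factor 2. *)
Lemma Ex_piv_norm (E : pred cfg) x :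
  Ex p (fun w => `|Diff p x (fun w => (E w)%:R) w|) = 2 * p * (1 - p) * Prob p (piv E x).
Proof.
rewrite -(Ex_Avg p x) -ExZ; apply: eq_Ex => w.
rewrite -sqr_Diff_indicator {1}/Avg /Diff !Avg_upd /Avg.
set a : R := (E (upd x true w))%:R; set b : R := (E (upd x false w))%:R.
have -> : a - (p * a + (1 - p) * b) = (1 - p) * (a - b) by ring.
have -> : b - (p * a + (1 - p) * b) = p * - (a - b) by ring.
have q0 : 0 < 1 - p by rewrite subr_gt0.
rewrite !normrM normrN (gtr0_norm p0) (gtr0_norm q0).
have -> : `|a - b| = (a - b) ^+ 2; last by ring.
rewrite /a /b; case: (E _); case: (E _) => /=;
  by rewrite ?subrr ?subr0 ?sub0r ?normrN ?sqrrN ?normr0 ?normr1 ?expr1n ?expr0n.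
Qed.

(** [k] will be the side of the torus: [ln k] is the gain over Poincare's inequality, and the
    subtracted term, quadratic in [I], is then small. *)
Lemma influence_inequality (E : pred cfg) (I k : R) : p <= 1 / 2 -> 0 < k ->
  (forall x, Prob p (piv E x) = I) ->
  Prob p E * (1 - Prob p E) * (ln k + 1)
    - k * (#|V|%:R * (2 * p * (1 - p) * I) ^+ 2)
  <= log_sobolev_const p * (#|V|%:R * (p * (1 - p) * I)).
Proof.
move=> ph k0 HI.
have := falik_samorodnitsky p0 p1 (fun w => (E w)%:R) ph k0.
under eq_bigr do rewrite Ex_piv_norm HI.
under [X in _ <= _ * X]eq_bigr do rewrite Ex_piv_Diff HI.
rewrite !sumr_const -[X in _ - k * X]mulr_natl -[X in _ <= _ * X]mulr_natl.
have -> // : variance p (fun w => (E w)%:R) = Prob p E * (1 - Prob p E).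
rewrite /variance mulrBr mulr1 -expr2; congr (_ - _).
by apply: eq_Ex => w; case: (E w); rewrite ?expr1n ?expr0n.
Qed.

Lemma depends_pred (A : {set V}) (E : pred cfg) :
  (forall w w', {in A, w =1 w'} -> E w = E w') ->
  depends A (fun w => (E w)%:R : R).
Proof. by move=> EA w w' /EA ->. Qed.

Lemma Prob_none (I : finType) (A : I -> {set V}) (E : I -> pred cfg) (D : {set I}) :
  (forall i w w', {in A i, w =1 w'} -> E i w = E i w') ->
  {in D &, forall i j, i != j -> [disjoint A i & A j]} ->
  Prob p (fun w => [forall i in D, ~~ E i w]) = \prod_(i in D) (1 - Prob p (E i)).
Proof.
move=> dep dis.
have all_none w : ([forall i in D, ~~ E i w])%:R = \prod_(i <- enum D) (~~ E i w)%:R :> R.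
  rewrite big_enum /=; case: forall_inP => [H|H].
    by rewrite big1 // => i /H ->.
  have [i iD Ei] : exists2 i, i \in D & E i w.
    by apply: contra_notP H => H i iD; apply/negP => Ei; apply: H; exists i.
  by rewrite (bigD1 i) //= Ei mul0r.
rewrite /Prob (eq_Ex p all_none) -[RHS]big_enum /=.
have sD : {subset enum D <= D} by move=> i; rewrite mem_enum.
elim: (enum D) (enum_uniq D) sD => [|i s IH].
  by move=> _ _; rewrite big_nil -[RHS](Ex_cst V p); apply: eq_Ex => w; rewrite big_nil.
rewrite cons_uniq => /andP[is_ us] sD; rewrite big_cons -IH //; last first.
  by move=> j js; apply: sD; rewrite inE js orbT.
rewrite -(ProbC p (E i)) -(@Ex_indep _ _ _ (A i) (\bigcup_(j in [set j in s]) A j)).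
- by apply: eq_Ex => w; rewrite big_cons.
- by move=> w w' ww'; rewrite (dep i w w').
- move=> w w' ww'; rewrite !big_seq; apply: eq_bigr => j js; rewrite (dep j w w') //.
  by move=> v vA; apply: ww'; apply/bigcupP; exists j; rewrite ?inE.
- rewrite -setI_eq0; apply/eqP/setP => v; rewrite !inE; apply/negP => /andP[vi].
  move=> /bigcupP[j]; rewrite inE => js vj.
  have ij : i != j by apply: contraNneq is_ => ->.
  have := dis i j (sD _ (mem_head _ _)) (sD _ _) ij; rewrite inE js orbT => /(_ isT).
  by rewrite -setI_eq0 => /eqP/setP/(_ v); rewrite !inE vi vj.
Qed.

Lemma Prob_none_le (I : finType) (A : I -> {set V}) (E : I -> pred cfg) (D : {set I}) (r : R) :
  (forall i w w', {in A i, w =1 w'} -> E i w = E i w') ->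
  {in D &, forall i j, i != j -> [disjoint A i & A j]} ->
  0 <= r -> (forall i, r <= Prob p (E i)) ->
  Prob p (fun w => [forall i in D, ~~ E i w]) <= expR (- (r * #|D|%:R)).
Proof.
move=> dep dis r0 rE; rewrite (Prob_none dep dis).
have -> : expR (- (r * #|D|%:R)) = \prod_(i in D) expR (- r).
  by rewrite prodr_const -expRM_natr mulNr.
apply: ler_prod => i _; have := rE i; have := Prob_le1 p0 p1 (E i).
have := expR_ge1Dx (- r) => *; apply/andP; split; lra.
Qed.

Lemma count_tail (A : {set V}) (l t : R) : 0 <= l ->
  Prob p (fun w => t <= count_in R A w) <=
    expR (p * #|A|%:R * (expR l - 1) - l * t).
Proof.
move=> l0; rewrite expRD expRN ler_pdivlMr ?expR_gt0 //.
apply: le_trans (mgf p0 p1 A l); rewrite mulrC -ExZ.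
apply: Ex_le => // w; case: (leP t (count_in R A w)) => h /=; last by rewrite mulr0 expR_ge0.
by rewrite mulr1 ler_expR ler_wpM2l.
Qed.

(* [E] depends on the sites of [A] only, so its total influence is the covariance
   with the number of occupied sites of [A], which is controlled by the upper tail of
   that number. *)
Lemma influence_upper (E : pred cfg) (A : {set V}) (a l : R) :
  increasing E -> (forall w w', {in A, w =1 w'} -> E w = E w') ->
  0 < l -> l <= 1 ->
  p * (1 - p) * \sum_x Prob p (piv E x) <=
    a * Prob p E + l^-1 * expR (2 * (p * #|A|%:R) * l ^+ 2 - l * a).
Proof.
move=> incE depE l0 l1.
have -> : p * (1 - p) * \sum_x Prob p (piv E x) =
    Ex p (fun w => (count_in R A w - p * #|A|%:R) * (E w)%:R).
  rewrite mulr_sumr (bigID (mem A)) /= [X in _ + X]big1 ?addr0 => [|x xA]; last first.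
    rewrite /Prob (_ : (fun w => _) = fun=> 0) ?Ex_cst ?mulr0 //.
    apply/funext => w; rewrite /piv (_ : E (flipv x w) = E w) ?eqxx //.
    by apply: depE => v vA; rewrite ffunE; case: eqP => // E'; rewrite -E' vA in xA.
  under eq_bigr do rewrite Prob_pivotal //.
  rewrite -Ex_sum; apply: eq_Ex => w; rewrite -mulr_suml; congr (_ * _).
  by rewrite sumrB sumr_const -[p *+ _]mulr_natr.
set M := p * #|A|%:R.
(* On [E], with [c] occupied sites in [A], [c - M <= a + l^-1 * expR (l * (c - M - a))] because
   [t <= expR t]; off [E] the left side is 0. The tail thereby becomes an exponential moment. *)
apply: (@le_trans _ _ (Ex p (fun w => a * (E w)%:R +
    (l^-1 * expR (- (l * (M + a)))) * expR (l * count_in R A w)))); last first.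
  rewrite ExD !ExZ lerD2l -[leLHS]mulrA ler_pM2l ?invr_gt0 //.
  apply: (@le_trans _ _ (expR (- (l * (M + a))) * expR (M * (expR l - 1)))).
    by rewrite ler_pM2l ?expR_gt0 //; exact: mgf.
  rewrite -expRD ler_expR.
  have el := expR_le_quad (ltW l0) l1.
  have M0 : 0 <= M by rewrite mulr_ge0 // ltW.
  have := ler_wpM2l M0 el; lra.
apply: Ex_le => // w; case: (E w); rewrite ?mulr1 ?mulr0; last first.
  by rewrite add0r mulr_ge0 ?expR_ge0 // mulr_ge0 ?invr_ge0 ?expR_ge0 // ltW.
rewrite -mulrA -expRD -lerBlDl -ler_pdivrMl ?invr_gt0 // invrK.
have := expR_ge1Dx (- (l * (M + a)) + l * count_in R A w).
move: (count_in R A w) => c; lra.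
Qed.

End Generic.

(** * Estimates at fixed size *)

Section TorusProb.
Variables (R : realType) (d m : nat) (p : R).
Local Notation n := m.+3.
Local Notation V := {ffun 'I_d -> 'I_m.+3}.
Local Notation site := (torus d m.+3).
Local Notation cfg := {ffun site -> bool}.
Local Notation Cn := (@complete_occupation d m.+3).
Hypotheses (p0 : 0 < p) (p1 : p < 1) (d1 : (1 < d)%N).
Implicit Types (w : cfg) (c x y : site).

Lemma PrE (E : pred (config d n)) : Pr p E = Prob p E.
Proof.
rewrite /Pr big_mkcond; apply: eq_bigr => w _.
by case: (E w); rewrite ?mulr1 ?mulr0.
Qed.

Lemma occupied_increasing w w' : (forall v, w v -> w' v) ->
  @occupied d n w \subset @occupied d n w'.
Proof. by move=> ww'; apply/subsetP => v; rewrite !inE; exact: ww'. Qed.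

Lemma nucleates_increasing L r c : increasing (@nucleates d m L r c).
Proof.
move=> w w' /occupied_increasing sub; apply: has_segment_sub.
by apply: cl_mono; exact: setSI.
Qed.

Lemma nucleates_depends L r c w w' : {in window r c, w =1 w'} ->
  @nucleates d m L r c w = @nucleates d m L r c w'.
Proof.
move=> ww'; rewrite /nucleates; congr (has_segment L (cl _)).
apply/setP => v; rewrite !inE; case: (boolP (close_to r c v)) => vc; last by rewrite !andbF.
by rewrite ww' // inE.
Qed.

Lemma Prob_shift (E F : pred cfg) (a : V) :
  (forall w, E (@shift_config d m a w) = F w) -> Prob p E = Prob p F.
Proof.
move=> EF; rewrite -(eq_Prob p EF).
apply/esym/(@Ex_reindex _ site p (fun v : V => v - a) (fun v : V => v + a)
  (fun w => (E w)%:R)) => v; [exact: subrK|exact: addrK].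
Qed.

Lemma Prob_piv_shift x : Prob p (piv Cn x) = Prob p (piv Cn (0 : V)).
Proof.
apply: (@Prob_shift _ _ (x : V)) => w; rewrite /piv complete_occupation_shift.
congr (_ != _); rewrite -[RHS](complete_occupation_shift (x : V)).
by rewrite -flip_shift add0r.
Qed.

Lemma Prob_nucleates_shift L r c :
  Prob p (@nucleates d m L r c) = Prob p (@nucleates d m L r (0 : V)).
Proof.
apply: (@Prob_shift _ _ (c : V)) => w.
by have := @nucleates_shift d m (c : V) L r (0 : V) w; rewrite add0r.
Qed.

Lemma Prob_misses_segment L : (L <= n)%N ->
  Prob p (fun w => ~~ meets_segments L (@occupied d n w))
    <= d%:R * n%:R ^+ d * (1 - p) ^+ L.
Proof.
move=> Ln.
pose seg (q : site * 'I_d) : {set site} :=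
  [set (q.1 : V) + pr (axis q.2 (Posz k)) | k : 'I_L].
have cseg q : #|seg q| = L.
  rewrite card_imset ?card_ord // => k l /addrI /ffunP /(_ q.2).
  rewrite !ffunE eqxx => E; apply/ord_inj.
  have lt : (`|(Posz k - Posz l)%R|%N < n)%N by have := ltn_ord k; have := ltn_ord l; lia.
  by case: (int_mod_inj E lt).
apply: (@le_trans _ _ (Prob p (fun w => [exists q, xpredT q && [forall v in seg q, ~~ w v]]))).
  apply: Prob_le => // w; rewrite negb_forall => /existsP[x]; rewrite negb_forall.
  move=> /existsP[i]; rewrite negb_exists => /forallP H.
  apply/existsP; exists (x, i) => /=; apply/forall_inP => v /imsetP[k _ ->].
  by have := H k; rewrite inE.
apply: le_trans (Prob_exists _ _ _ _) _ => //.
under eq_bigr do rewrite Prob_all_false cseg.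
by rewrite sumr_const card_prod card_ord card_site -[leLHS]mulr_natl natrM natrX mulrC
  [d%:R * _]mulrC mulrC lexx.
Qed.

Lemma tube_in_window c i k L l (g : {ffun 'I_d.-1 -> 'I_k}) : (k <= L)%N -> (l < L)%N ->
  close_to L c ((c : V) + pr (tube_point i l g)).
Proof.
move=> kL lL; apply/close_toP => j; rewrite !ffunE.
case: unliftP => [t|] E; last by exists (Posz l) => //=; exact: ltnW.
by exists (Posz (g t)) => //=; apply: leq_trans (ltnW (ltn_ord _)) kL.
Qed.

(* The seeds fill the base of a tube of width [k], which then grows layer by layer. *)
Definition tube_event (i : 'I_d) (k L : nat) c : pred cfg := fun w =>
  [forall v in tube_seeds c i k, w v] &&
  [forall l : 'I_L, (0 < l)%N ==> [exists v in tube_layer c i k l, w v]].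

Lemma tube_event_depends i k L c w w' : (k <= L)%N -> {in window L c, w =1 w'} ->
  tube_event i k L c w = tube_event i k L c w'.
Proof.
move=> kL.
suff imp (u u' : cfg) : {in window L c, u =1 u'} -> tube_event i k L c u -> tube_event i k L c u'.
  move=> ww'; apply/idP/idP; apply: imp => // v vc; exact/esym/ww'.
move=> uu' /andP[/forall_inP seeds /forallP layers]; apply/andP; split.
  apply/forall_inP => v vs; rewrite -uu' ?seeds // inE.
  have /imsetP[[j t] _ ->] := vs; apply/close_toP => s; rewrite !ffunE /=.
  exists (if s == j then Posz t else 0) => //; case: ifP => //= _.
  exact: leq_trans (ltnW (ltn_ord t)) kL.
apply/forallP => l; apply/implyP => l0; have := layers l; rewrite l0 /=.
move=> /exists_inP[v vl uv]; apply/exists_inP; exists v => //.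
rewrite -uu' // inE; have /imsetP[g _ ->] := vl; exact: tube_in_window.
Qed.

Lemma tube_event_segment i k L c w : (0 < k)%N -> tube_event i k L c w ->
  has_segment L (cl (@occupied d n w)).
Proof.
move=> k0 /andP[/forall_inP seeds /forallP layers].
apply: (@tube_segment d m _ c i k L (cl_closed _) d1 k0).
  by apply: subset_trans (sub_cl _); apply/subsetP => v /seeds wv; rewrite inE.
move=> l /andP[l0 lL]; have := layers (Ordinal lL); rewrite /= l0 /=.
move=> /exists_inP[v vl wv]; exists v => //; apply: (subsetP (sub_cl _)).
by rewrite inE.
Qed.

(** The seeds lie in layer 0 and the other requirements in layers 1 to [L - 1], which [L <= n] keeps
    disjoint from it; so the two factors are independent. *)
Lemma Prob_tube_event i k L c : (0 < k)%N -> (k <= L)%N -> (L <= n)%N ->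
  p ^+ (d * k) * (1 - L%:R * (1 - p) ^+ (k ^ d.-1)) <= Prob p (tube_event i k L c).
Proof.
move=> k0 kL Ln.
pose S := tube_seeds c i k.
pose T := \bigcup_(l : 'I_L | (0 < l)%N) tube_layer c i k l.
pose F w := [forall l : 'I_L, (0 < l)%N ==> [exists v in tube_layer c i k l, w v]].
have si v : v \in S -> (v : V) i = (c : V) i.
  by move=> /imsetP[[j t]]; rewrite inE /= => ji ->; rewrite !ffunE eq_sym (negPf ji) addr0.
have dis : [disjoint S & T].
  rewrite -setI_eq0; apply/eqP/setP => v; rewrite !inE; apply/negP => /andP[/si vi].
  move=> /bigcupP[l l0 /imsetP[g _ vE]]; move: vi; rewrite vE !ffunE unlift_none.
  move=> /eqP; rewrite -subr_eq0 addrAC subrr add0r => /eqP.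
  move=> /(@int_mod_inj m l 0); have := ltn_ord l; rewrite subr0 /= => h1 h2.
  by have := h2 (leq_trans h1 Ln); lia.
have -> : Prob p (tube_event i k L c) = p ^+ #|S| * Prob p F.
  rewrite -Prob_all_true -(@Ex_indep _ _ _ S T) //.
  - by apply: eq_Ex => w; rewrite -natrM mulnb.
  - apply: depends_pred => w w' ww'; apply/forall_inP/forall_inP => H v vS.
      by rewrite -ww' ?H.
    by rewrite ww' ?H.
  - apply: depends_pred => w w' ww'; apply: eq_forallb => l.
    case: (ltnP 0 l) => //= l0; apply: eq_existsb => v.
    case: (boolP (v \in _)) => //= vl; apply: ww'; apply/bigcupP; by exists l.
have pS : p ^+ (d * k) <= p ^+ #|S|.
  by rewrite ler_wiXn2l ?ltW // card_tube_seeds.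
have [neg|pos] := leP (1 - L%:R * (1 - p) ^+ (k ^ d.-1)) 0.
  apply: (@le_trans _ _ 0); first by rewrite mulr_ge0_le0 // exprn_ge0 // ltW.
  by rewrite mulr_ge0 ?Prob_ge0 // exprn_ge0 // ltW.
apply: ler_pM => //; [by rewrite exprn_ge0 // ltW|exact: ltW|].
rewrite lerBlDr -lerBlDl -ProbC.
apply: (@le_trans _ _ (Prob p (fun w =>
  [exists l : 'I_L, (0 < l)%N && [forall v in tube_layer c i k l, ~~ w v]]))).
  apply: Prob_le => // w; rewrite negb_forall => /existsP[l]; rewrite negb_imply.
  move=> /andP[l0]; rewrite negb_exists => /forallP H; apply/existsP; exists l.
  rewrite l0; apply/forall_inP => v vl; have := H v; by rewrite vl.
apply: le_trans (Prob_exists p0 p1 _ _) _.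
under eq_bigr do rewrite Prob_all_false card_tube_layer ?(leq_trans kL) //.
rewrite sumr_const -[leLHS]mulr_natl ler_wpM2r //; first by rewrite exprn_ge0 // subr_ge0 ltW.
by rewrite ler_nat; apply: leq_trans (max_card _) _; rewrite card_ord.
Qed.

Lemma segment_meets_complete L w : (0 < L)%N ->
  meets_segments L (@occupied d n w) -> has_segment L (cl (@occupied d n w)) -> Cn w.
Proof.
move=> L0 /meets_segmentsP meets seg; rewrite complete_occupationE; apply/eqP.
apply: (segment_fills_torus (cl_closed _) d1 L0 seg) => x i.
by have [k kL h] := meets x i; exists k => //; exact: (subsetP (sub_cl _)).
Qed.

(* Some tube of a packing nucleates, and its axis then sweeps the torus. *)
Theorem incomplete_upper k L : (0 < k)%N -> (k <= L)%N -> (L <= n)%N ->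
  L%:R * (1 - p) ^+ (k ^ d.-1) <= 1 ->
  exists2 N : nat, (n ^ d <= N * L.*2.*2.+1 ^ d)%N &
  1 - Pr p Cn <= d%:R * n%:R ^+ d * (1 - p) ^+ L +
    expR (- (p ^+ (d * k) * (1 - L%:R * (1 - p) ^+ (k ^ d.-1)) * N%:R)).
Proof.
move=> k0 kL Ln small; have [D [dis _ cardD _]] := window_packing d m L.
exists #|D| => //; pose i := Ordinal (ltnW d1).
apply: le_trans (lerD (Prob_misses_segment Ln) _); last first.
  apply: (@Prob_none_le _ _ p p0 p1 _ (window L) (tube_event i k L) D).
  - by move=> c w w'; exact: tube_event_depends.
  - exact: dis.
  - by rewrite mulr_ge0 ?exprn_ge0 ?subr_ge0 // ltW.
  - by move=> c; exact: Prob_tube_event.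
rewrite PrE -ProbC; apply: le_trans (ProbU p0 p1 _ _); apply: Prob_le => // w nC.
rewrite -implyNb negbK; apply/implyP => meets; apply/forall_inP => c _.
apply: contraNN nC => tube; apply: (segment_meets_complete _ meets).
  exact: leq_trans kL.
exact: tube_event_segment tube.
Qed.

(** Aizenman-Lebowitz at scale [2 s - 1] gives a segment of [2 s] sites spanned inside a window of
    radius [4 s], which then holds at least [s] occupied sites by [segment_card]. Chernoff's bound
    and a union over windows conclude. *)
Theorem complete_upper s l : (0 < s)%N -> (4 * s <= n)%N -> 0 <= l ->
  Pr p Cn <= n%:R ^+ d * expR (p * (8 * s)%N.+1%:R ^+ d * (expR l - 1) - l * s%:R).
Proof.
move=> s0 sn l0.
pose E (x : site) : pred cfg := fun w => s%:R <= count_in R (window (4 * s) x) w.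
rewrite PrE; apply: (@le_trans _ _ (Prob p (fun w => [exists x, xpredT x && E x w]))).
  apply: Prob_le => // w; rewrite complete_occupationE => /eqP clT.
  have d0 := ltnW d1.
  have [|x] := @aizenman_lebowitz d m (occupied w) (2 * s).-1 d0 _ clT; first lia.
  have -> : ((2 * s).-1.*2.+2 = 4 * s)%N by lia.
  have -> : ((2 * s).-1.+1 = 2 * s)%N by lia.
  move=> /segment_card h; apply/existsP; exists x; rewrite /= /E.
  have -> : count_in R (window (4 * s) x) w = #|occupied w :&: window (4 * s) x|%:R.
    rewrite /count_in -sum1_card natr_sum big_mkcond [RHS]big_mkcond /=.
    apply: eq_bigr => v _; rewrite !inE; case: (w v); case: (close_to _ _ _) => //=.
  by rewrite ler_nat; apply: leq_trans (h _); lia.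
apply: le_trans (Prob_exists p0 p1 _ _) _.
have Ele x : Prob p (E x) <= expR (p * (8 * s)%N.+1%:R ^+ d * (expR l - 1) - l * s%:R).
  apply: le_trans (count_tail p0 p1 _ _ l0) _; rewrite ler_expR lerD2r.
  have el : 0 <= expR l - 1 by have := expR_ge1Dx l; lra.
  rewrite ler_wpM2r // ler_pM2l // -natrX ler_nat.
  apply: leq_trans (card_window_le _ _) _.
  by rewrite leq_eqVlt; apply/orP; left; apply/eqP; congr (_ ^ _)%N; lia.
apply: (@le_trans _ _ (\sum_(x : site) expR (p * (8 * s)%N.+1%:R ^+ d * (expR l - 1) - l * s%:R))).
  by apply: ler_sum.
by rewrite sumr_const card_site -[leLHS]mulr_natl natrX.
Qed.

(* Up to the event that some segment of [h] sites is vacant, complete occupation is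
   the union over the centres of a packing of the local events [nucleates], both for a
   configuration and for its flip.  A second, sparser packing bounds the number of
   centres times the probability [r] of one such event; [17 h] bounds the side of a
   window of radius [8 h], and [33] the ratio of the scales of the packings. *)
Theorem pivotal_upper h (a l : R) : (0 < h)%N -> (8 * h < n)%N -> 0 < l -> l <= 1 ->
  exists N N' : nat, [/\ (N <= n ^ d)%N, (N <= N' * 33 ^ d)%N &
  exists2 r : R, 0 <= r /\
    1 - Pr p Cn - d%:R * n%:R ^+ d * (1 - p) ^+ h <= expR (- (r * N'%:R)) &
  p * (1 - p) * (n%:R ^+ d * Pr p (pivotal Cn (0 : V))) <=
    n%:R ^+ d * (d%:R * n%:R ^+ d * (1 - p) ^+ h) +
    N%:R * (a * r + l^-1 * expR (2 * (p * (17 * h)%N%:R ^+ d) * l ^+ 2 - l * a))].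
Proof.
move=> h0 hn l0 l1.
have [D [_ cover _ cardD]] := window_packing d m h.
have [D' [dis' _ cardD' _]] := window_packing d m (8 * h).
have hnn : (h < n)%N by lia.
exists #|D|, #|D'|; split.
- apply: leq_trans (cardD hnn); rewrite leq_pmulr // expn_gt0 //.
- have h1 : (#|D| * h.+1 ^ d <= #|D'| * (8 * h).*2.*2.+1 ^ d)%N.
    exact: leq_trans (cardD hnn) cardD'.
  rewrite -(leq_pmul2r (_ : (0 < h.+1 ^ d)%N)) ?expn_gt0 // (leq_trans h1) //.
  rewrite -mulnA -expnMn leq_mul2l leq_exp2r ?(ltnW d1) //; apply/orP; right; lia.
pose E := @nucleates d m h.*2 (8 * h).
pose r := Prob p (E (0 : V)).
pose G L w := meets_segments L (@occupied d n w).
have nuc_C c w : G h.*2 w -> E c w -> Cn w.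
  move=> meets nuc; apply: (segment_meets_complete _ meets); first lia.
  by apply: has_segment_sub nuc; apply: cl_mono; exact: subsetIl.
(* The segment is spanned in a window of radius [4 h] whose centre is within [2 h] of some [c]; the
   radius [8 h] leaves room. *)
have C_nuc w : Cn w -> exists2 c, c \in D & E c w.
  rewrite complete_occupationE => /eqP clT.
  have [|x] := @aizenman_lebowitz d m (occupied w) h.*2.-1 (ltnW d1) _ clT; first lia.
  rewrite prednK ?double_gt0 // => seg.
  have [c cD xc] := cover x; exists c; first exact: cD.
  apply: has_segment_sub seg; apply/cl_mono/setIS/subsetP => v; rewrite !inE => xv.
  apply: close_to_leq (close_to_trans (close_to_sym xc) xv); lia.
exists r.
  split; first exact: Prob_ge0.
  (* Up to vacant segments, incompleteness makes the independent events at the centres of [D'] all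
     fail, so a lower bound on its probability bounds [r * #|D'|]. *)
  have := @Prob_none_le _ _ p p0 p1 _ (window (8 * h)) E D' r.
  move=> /(_ (@nucleates_depends _ _) dis' (Prob_ge0 p0 p1 _)) => H.
  apply: le_trans (H _); last by move=> c; rewrite /E Prob_nucleates_shift.
  have hp : (1 - p) ^+ h.*2 <= (1 - p) ^+ h.
    rewrite ler_wiXn2l ?subr_ge0 ?(ltW p1) ?lerBlDr ?lerDl ?(ltW p0) //.
    by rewrite -addnn leq_addl.
  rewrite lerBlDl PrE -ProbC.
  apply: (@le_trans _ _ (Prob p (fun w => ~~ G h w || [forall c in D', ~~ E c w]))).
    apply: Prob_le => // w nC; rewrite -implyNb negbK; apply/implyP => meets.
    apply/forall_inP => c _; apply: contraNN nC; apply: nuc_C.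
    apply/meets_segmentsP => x i; have /meets_segmentsP/(_ x i)[k kh hk] := meets.
    by exists k => //; lia.
  apply: le_trans (ProbU p0 p1 _ _) _; rewrite lerD2r.
  by apply: Prob_misses_segment; lia.
have pvC x : Prob p (piv Cn x) <= d%:R * n%:R ^+ d * (1 - p) ^+ h +
    \sum_(c in D) Prob p (piv (E c) x).
  apply: (@le_trans _ _ (Prob p (fun w => ~~ G h w || [exists c, (c \in D) && piv (E c) x w]))).
    apply: Prob_le => // w pC; rewrite -implyNb negbK; apply/implyP => meets.
    have mw : G h.*2 w.
      apply/meets_segmentsP => y i; have /meets_segmentsP/(_ y i)[k kh hk] := meets.
      by exists k => //; lia.
    (* The flip may empty a segment of length [h]; this is why the local events ask for length
       [2 h]. *)
    have mf : G h.*2 (flipv x w) by apply: meets_segments_flip meets; lia.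
    have CE w' : G h.*2 w' -> Cn w' = [exists c, (c \in D) && E c w'].
      move=> mw'; apply/idP/existsP => [/C_nuc[c cD cE]|[c /andP[_]]].
        by exists c; rewrite cD.
      exact: nuc_C.
    apply: contraT; rewrite negb_exists => /forallP H.
    move: pC; rewrite /piv (CE _ mw) (CE _ mf) => /eqP[]; apply: eq_existsb => c.
    by have := H c; case: (c \in D) => //=; rewrite /piv negbK => /eqP.
  apply: le_trans (ProbU p0 p1 _ _) _; apply: lerD.
    by apply: Prob_misses_segment; lia.
  exact: Prob_exists.
have infl c : p * (1 - p) * \sum_x Prob p (piv (E c) x) <=
    a * r + l^-1 * expR (2 * (p * (17 * h)%N%:R ^+ d) * l ^+ 2 - l * a).
  apply: le_trans (@influence_upper _ _ p p0 p1 (E c) (window (8 * h) c) a l _ _ l0 l1) _.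
  - exact: nucleates_increasing.
  - exact: nucleates_depends.
  rewrite /E Prob_nucleates_shift -/E -/r lerD2l ler_pM2l ?invr_gt0 // ler_expR lerD2r.
  rewrite ler_wpM2r ?sqr_ge0 // ler_pM2l // ler_pM2l // -natrX ler_nat.
  apply: leq_trans (card_window_le _ _) _; rewrite leq_exp2r ?(ltnW d1) //; lia.
have q0 : 0 < 1 - p by rewrite subr_gt0.
have -> : n%:R ^+ d * Pr p (pivotal Cn (0 : V)) = \sum_(x : site) Prob p (piv Cn x).
  under eq_bigr do rewrite Prob_piv_shift.
  by rewrite sumr_const card_site -[RHS]mulr_natl natrX PrE.
apply: (@le_trans _ _ (p * (1 - p) * \sum_(x : site) (d%:R * n%:R ^+ d * (1 - p) ^+ h +
    \sum_(c in D) Prob p (piv (E c) x)))).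
  by rewrite ler_pM2l ?mulr_gt0 //; apply: ler_sum.
rewrite big_split /= sumr_const card_site -(mulr_natl _ (n ^ d)%N) natrX mulrDr.
apply: lerD.
  rewrite -[leRHS]mul1r ler_wpM2r //; last by nra.
  by rewrite !mulr_ge0 ?exprn_ge0 // ltW.
rewrite exchange_big /= mulr_sumr -sumr_const mulr_suml.
by apply: ler_sum => c _; rewrite mul1r.
Qed.

End TorusProb.

(** * Asymptotics *)

Section Eventually.
Variable R : realType.
Implicit Types (x y a b c C : R) (P Q : R -> Prop).

(** [x] stands for [ln n]. Quantifying over the density inside [P] makes the threshold uniform in
    it. *)
Definition evt P := exists M : R, forall x, M <= x -> P x.

Lemma evt_and P Q : evt P -> evt Q -> evt (fun x => P x /\ Q x).
Proof.
move=> [M HM] [M' HM']; exists (Num.max M M') => x; rewrite ge_max => /andP[h h'].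
by split; [exact: HM|exact: HM'].
Qed.

Lemma evt_impl P Q : evt P -> (forall x, P x -> Q x) -> evt Q.
Proof. by move=> [M HM] PQ; exists M => x /HM /PQ. Qed.

Lemma evt_ge a : evt (fun x => a <= x).
Proof. by exists a. Qed.

Lemma powR_ge1 x a : 1 <= x -> 0 <= a -> 1 <= x `^ a.
Proof. by move=> x1 a0; rewrite -(powRr0 x) ler_powR. Qed.

Lemma powR_le2 x y a : 0 <= a -> 0 <= x -> x <= y -> x `^ a <= y `^ a.
Proof.
move=> a0 x0 xy; apply: ge0_ler_powR => //; rewrite nnegrE //.
exact: le_trans xy.
Qed.

Lemma evt_powR_ge a C : 0 < a -> evt (fun x => C <= x `^ a).
Proof.
move=> a0; pose D := Num.max 1 C; exists (D `^ a^-1) => x hx.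
have D0 : 0 <= D by rewrite le_max ler01.
apply: (@le_trans _ _ D); first by rewrite le_max lexx orbT.
have -> : D = (D `^ a^-1) `^ a by rewrite -powRrM mulVf ?gt_eqF // powRr1.
by apply: powR_le2 => //; [exact: ltW|exact: powR_ge0].
Qed.

Lemma evt_comp_powR a P : 0 < a -> evt P -> evt (fun x => P (x `^ a)).
Proof.
move=> a0 [M HM]; apply: evt_impl (evt_powR_ge M a0) _ => x; exact: HM.
Qed.

Lemma powRDp x a b : 0 < x -> x `^ (a + b) = x `^ a * x `^ b.
Proof. by move=> x0; rewrite powRD // (gt_eqF x0) implybT. Qed.

Lemma evt_powR_le C a b : a < b -> evt (fun x => C * x `^ a <= x `^ b).
Proof.
move=> ab; have h : 0 < b - a by rewrite subr_gt0.
apply: evt_impl (evt_and (evt_powR_ge C h) (evt_ge 1)) _ => x [hC x1].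
have x0 : 0 < x by lra.
rewrite -[X in _ <= _ `^ X](subrK a b) powRDp // ler_wpM2r //; exact: powR_ge0.
Qed.

Lemma ln_le_powR x a : 0 < a -> 0 < x -> ln x <= a^-1 * x `^ a.
Proof.
move=> a0 x0; rewrite -ler_pdivrMl ?invr_gt0 // invrK -ln_powR.
by apply/ltW/ln_sublinear/powR_gt0.
Qed.

Lemma powR_expR x a : 0 < x -> x `^ a = expR (a * ln x).
Proof. by move=> x0; rewrite /powR gt_eqF. Qed.

Lemma evt_powR_expR C a b : 0 < b -> evt (fun x => C * x `^ a <= expR (b * x)).
Proof.
move=> b0; pose D := Num.max 1 C.
have h0 : (0 : R) < 2^-1 by rewrite invr_gt0.
have h1 : (2^-1 : R) < 1 by lra.
apply: evt_impl (evt_and (evt_ge 1) (evt_powR_le ((ln D + 2 * `|a|) / b) h1)) _.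
move=> x [x1 hx]; have x0 : 0 < x by lra.
have D0 : 0 < D by rewrite lt_max ltr01.
apply: (@le_trans _ _ (D * x `^ a)).
  by rewrite ler_wpM2r ?powR_ge0 // le_max lexx orbT.
rewrite powR_expR // -[D](@lnK R) ?posrE // -expRD ler_expR.
have := ln_le_powR h0 x0; rewrite invrK => hl.
have s1 : 1 <= x `^ 2^-1 by apply: powR_ge1 => //; exact: ltW.
have lx : 0 <= ln x by exact: ln_ge0.
have lD : 0 <= ln D by apply: ln_ge0; rewrite le_max lexx.
have al : a * ln x <= `|a| * (2 * x `^ 2^-1).
  apply: (@le_trans _ _ (`|a| * ln x)); first by rewrite ler_wpM2r // ler_norm.
  by rewrite ler_wpM2l.
have lD' : ln D <= ln D * x `^ 2^-1 by rewrite ler_peMr.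
rewrite (powRr1 (ltW x0)) mulrAC ler_pdivrMr // mulrDl in hx.
lra.
Qed.

Lemma evt_powR_exp_powR C a b : 0 < b -> evt (fun x => C * x `^ a * expR (- x `^ b) <= 1).
Proof.
move=> b0; have := evt_comp_powR b0 (@evt_powR_expR C (a / b) 1 ltr01).
move=> /evt_and - /(_ _ (evt_ge 1)) h; apply: evt_impl h _ => x [hx x1].
rewrite -powRrM mulrCA divff ?gt_eqF // mulr1 mul1r in hx.
by rewrite expRN ler_pdivrMr ?expR_gt0 // mul1r.
Qed.

Lemma evt_nat P : evt P -> exists n0 : nat, forall n, (n0 <= n)%N -> P (ln n%:R).
Proof.
move=> [M HM]; exists (Num.truncn (expR M)).+1 => n hn; apply: HM.
have h : expR M < n%:R.
  by apply: lt_le_trans (truncnS_gt _) _; rewrite ler_nat.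
rewrite -ler_expR lnK ?posrE; first exact: ltW.
exact: lt_trans (expR_gt0 _) h.
Qed.

Lemma exprB_le_expR (p : R) k : 0 <= p -> p <= 1 -> (1 - p) ^+ k <= expR (- (p * k%:R)).
Proof.
move=> p0 p1; rewrite -mulNr expRM_natr lerXn2r ?nnegrE ?expR_ge0 ?subr_ge0 //.
exact: expR_ge1Dx.
Qed.

End Eventually.

Lemma nat_above (R : realType) (y : R) : 0 <= y ->
  exists k : nat, [/\ (0 < k)%N, y < k%:R & k%:R <= y + 1].
Proof.
move=> y0; exists (Num.truncn y).+1; split=> //; first exact: truncnS_gt.
by rewrite -addn1 natrD lerD2r truncn_le.
Qed.

(** * Location of the critical density *)

Section Critical.
Variables (R : realType) (d : nat) (delta : R).
Hypotheses (d1 : (1 < d)%N) (delta0 : 0 < delta).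
Local Notation D := (d%:R : R).
Local Notation Cn m := (@complete_occupation d m.+3).

Let D2 : 2 <= D. Proof. by rewrite ler_nat. Qed.

Let DB1 : d.-1%:R = D - 1.
Proof. by rewrite -[in RHS](prednK (ltnW d1)) -addn1 natrD addrK. Qed.

Lemma expR_ln_nat (k : nat) : expR (ln k.+1%:R) = k.+1%:R :> R.
Proof. by rewrite lnK // posrE. Qed.

Lemma natX_expR (k : nat) (e : nat) : k.+1%:R ^+ e = expR (e%:R * ln k.+1%:R) :> R.
Proof. by rewrite expRM_natl expR_ln_nat. Qed.

(* Tubes of width [k ~ x^(1 - al)] and length [L ~ x^(d - eps)]. *)
Lemma critical_upper (eps : R) : 0 < eps -> eps < 1 ->
  evt (fun x => forall m p, x = ln m.+3%:R -> 0 < p -> p < 1 ->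
    Pr p (Cn m) < 1 - delta -> p <= x `^ (eps - (D - 1))).
Proof.
move=> e0 e1; have D2' := D2; have dl0 := delta0.
(* [(1 - al) (D - 1) = D - 1 - eps / 2], so at density above [x^(eps - (D - 1))] a layer of
   [k^(d-1)] sites is vacant with probability at most [exp (- x^(eps/2))], while [k ln x] stays
   small against [x]. *)
pose al := eps / (2 * (D - 1)).
have al0 : 0 < al by rewrite divr_gt0 //; lra.
have alE : al * (D - 1) = eps / 2 by rewrite /al; field; lra.
have al1 : al < 1 by rewrite ltr_pdivrMr; lra.
have F1 : evt (fun x : R => 2 * x `^ (1 - al) <= x `^ (D - eps)) by apply: evt_powR_le; lra.
have F2 : evt (fun x : R => (3 * D + 1) * x `^ (D - eps) <= x `^ D) by apply: evt_powR_le; lra.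
have F3 := evt_powR_expR 5 D (@ltr01 R).
have F4 : evt (fun x : R => 2 * x `^ D * expR (- x `^ (eps / 2)) <= 1).
  by apply: evt_powR_exp_powR; lra.
have F5 := evt_powR_expR (2 * D / delta) 0 (@ltr01 R).
have F6 : evt (fun x : R => 8 * D ^+ 2 / al * x `^ (1 - al / 2) <= x `^ 1).
  by apply: evt_powR_le; lra.
have h2 : (0 : R) < 2^-1 by lra.
have F7 := evt_powR_expR (10 * ln (2 / delta)) D h2.
have := evt_and F1 (evt_and F2 (evt_and F3 (evt_and F4 (evt_and F5 (evt_and F6 (evt_and F7 (evt_ge 1))))))).
move=> F; apply: evt_impl F _ => x [{}F1 [{}F2 [{}F3 [{}F4 [{}F5 [{}F6 [{}F7 x1]]]]]]].
move=> m p xE p0 p1; rewrite mul1r in F3; rewrite mul1r powRr0 mulr1 in F5.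
have x0 : 0 < x by lra.
have nE : m.+3%:R = expR x by rewrite xE expR_ln_nat.
rewrite powRr1 ?(ltW x0) // in F6.
apply: contraTT; rewrite -ltNge -leNgt => P1p; rewrite lerBlDr -lerBlDl.
set P1 := x `^ (eps - (D - 1)) in P1p.
have P10 : 0 < P1 by exact: powR_gt0.
have P1i : P1 * x `^ (D - 1 - eps) = 1.
  by rewrite -powRDp // (_ : eps - (D - 1) + (D - 1 - eps) = 0) ?powRr0 //; ring.
have [k [k0 klo khi]] := nat_above (powR_ge0 x (1 - al)).
(* The factor [3 D] gives [p L >= 3 D x], so a vacant segment of length [L] exists with probability
   at most [D n^(-2 D)]. *)
have [L [L0 Llo Lhi]] : exists L : nat, [/\ (0 < L)%N, 3 * D * x `^ (D - eps) < L%:R &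
   L%:R <= 3 * D * x `^ (D - eps) + 1] by apply: nat_above; rewrite mulr_ge0 ?powR_ge0 //; lra.
have y1 : 1 <= x `^ (1 - al) by apply: powR_ge1 => //; lra.
have y2 : 1 <= x `^ (D - eps) by apply: powR_ge1 => //; lra.
have k2 : k%:R <= 2 * x `^ (1 - al) by lra.
have Lx : L%:R <= x `^ D by lra.
have kL : (k <= L)%N.
  rewrite -(ler_nat R); apply: le_trans k2 _; apply: le_trans F1 _; apply/ltW.
  by apply: le_lt_trans Llo; rewrite ler_peMl ?powR_ge0 //; lra.
have xD0 := powR_ge0 x D.
have Ln : (L <= m.+3)%N by rewrite -(ler_nat R) nE; lra.
have pk : x `^ (eps / 2) <= p * (k ^ d.-1)%N%:R.
  have -> : x `^ (eps / 2) = P1 * (x `^ (1 - al)) ^+ d.-1.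
    rewrite -powR_mulrn ?powR_ge0 // -powRrM -powRDp // DB1; congr (_ `^ _).
    by rewrite mulrBl alE; field.
  apply: ler_pM; [exact: ltW|by rewrite exprn_ge0 ?powR_ge0|exact: ltW|].
  by rewrite natrX lerXn2r ?nnegrE ?powR_ge0 ?ler0n // ltW.
have small : L%:R * (1 - p) ^+ (k ^ d.-1) <= 1 / 2.
  apply: (@le_trans _ _ (x `^ D * expR (- x `^ (eps / 2)))); last by lra.
  apply: ler_pM => //; first by rewrite exprn_ge0 // subr_ge0 ltW.
  apply: le_trans (exprB_le_expR _ (ltW p0) (ltW p1)) _.
  by rewrite ler_expR lerN2.
have small1 : L%:R * (1 - p) ^+ (k ^ d.-1) <= 1 by lra.
have [N hN hP] := incomplete_upper p0 p1 d1 k0 kL Ln small1.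
apply: le_trans hP _.
have xp : x <= p * x `^ (D - eps).
  have E : P1 * x `^ (D - eps) = x.
    rewrite -powRDp // (_ : eps - (D - 1) + (D - eps) = 1) ?powRr1 ?(ltW x0) //; ring.
  by rewrite -[leLHS]E ler_wpM2r ?powR_ge0 // ltW.
have h1 : d%:R * m.+3%:R ^+ d * (1 - p) ^+ L <= delta / 2.
  apply: (@le_trans _ _ (D * expR (D * x) * expR (- (3 * D * x)))).
    rewrite natX_expR -xE; apply: ler_wpM2l; first by rewrite mulr_ge0 ?expR_ge0.
    apply: le_trans (exprB_le_expR _ (ltW p0) (ltW p1)) _.
    rewrite ler_expR lerN2.
    have : p * (3 * D * x `^ (D - eps)) <= p * L%:R by rewrite ler_wpM2l // ltW.
    have : 3 * D * x <= 3 * D * (p * x `^ (D - eps)) by rewrite ler_wpM2l //; lra.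
    lra.
  rewrite -mulrA -expRD.
  apply: (@le_trans _ _ (D * expR (- x))).
    rewrite ler_wpM2l ?ler_expR //.
    have : 1 * x <= D * x by rewrite ler_wpM2r //; lra.
    lra.
  rewrite expRN ler_pdivrMr ?expR_gt0 //.
  have h : delta / 2 * (2 * D / delta) = D by field; lra.
  rewrite -[leLHS]h ler_pM2l //; lra.
(* The seeds of one tube cost at most [n^(-1/2)]; the number [N] of disjoint windows, at least
   [n / (5 x^D)], overcomes this. *)
have h3 : expR (- (x / 2)) <= p ^+ (d * k).
  apply: (@le_trans _ _ (P1 ^+ (d * k))); last first.
    by rewrite lerXn2r ?nnegrE ?ltW.
  rewrite /P1 powR_expR // -expRM_natr ler_expR.
  have lx := ln_ge0 x1.
  have a2 : 0 < al / 2 by lra.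
  have hl := ln_le_powR a2 x0.
  have lk : ln x * k%:R <= (4 / al) * x `^ (1 - al / 2).
    apply: (@le_trans _ _ (((al / 2)^-1 * x `^ (al / 2)) * (2 * x `^ (1 - al)))).
      by apply: ler_pM.
    have -> : (al / 2)^-1 * x `^ (al / 2) * (2 * x `^ (1 - al)) =
        4 / al * (x `^ (al / 2) * x `^ (1 - al)) by field; lra.
    by rewrite -powRDp // (_ : al / 2 + (1 - al) = 1 - al / 2) //; field.
  have lk0 : 0 <= ln x * k%:R by rewrite mulr_ge0.
  rewrite natrM.
  have -> : (eps - (D - 1)) * ln x * (D * k%:R) = - (D * (D - 1 - eps) * (ln x * k%:R)) by ring.
  rewrite lerN2.
  apply: (@le_trans _ _ (D ^+ 2 * (ln x * k%:R))).
    by rewrite ler_wpM2r // expr2 ler_wpM2l //; lra.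
  apply: (@le_trans _ _ (D ^+ 2 * (4 / al * x `^ (1 - al / 2)))).
    by rewrite ler_wpM2l // sqr_ge0.
  have -> : D ^+ 2 * (4 / al * x `^ (1 - al / 2)) = (8 * D ^+ 2 / al * x `^ (1 - al / 2)) / 2.
    by field; lra.
  by rewrite ler_pM2r // invr_gt0.
have h4 : expR x / (5 * x `^ D) <= N%:R.
  have c0 : 0 < 5 * x `^ D by rewrite mulr_gt0 // powR_gt0.
  have t1 : 1 <= expR x / (5 * x `^ D) by rewrite ler_pdivlMr // mul1r.
  apply: (@le_trans _ _ ((expR x / (5 * x `^ D)) ^+ d)).
    by rewrite -[leLHS]expr1 ler_weXn2l // ltnW.
  rewrite expr_div_n ler_pdivrMr ?exprn_gt0 // -nE -natrX.
  apply: (@le_trans _ _ (N * L.*2.*2.+1 ^ d)%N%:R); first by rewrite ler_nat.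
  rewrite natrM natrX ler_wpM2l // lerXn2r ?nnegrE // ?ltW //.
  have -> : L.*2.*2.+1%:R = 4 * L%:R + 1 :> R.
    by rewrite -addn1 natrD -!muln2 !natrM; ring.
  have : 1 <= x `^ D by apply: powR_ge1 => //; lra.
  lra.
have h5 : ln (2 / delta) <= p ^+ (d * k) * (1 - L%:R * (1 - p) ^+ (k ^ d.-1)) * N%:R.
  apply: (@le_trans _ _ (expR (- (x / 2)) * (1 / 2) * (expR x / (5 * x `^ D)))).
    have -> : expR (- (x / 2)) * (1 / 2) * (expR x / (5 * x `^ D)) =
        (expR (- (x / 2)) * expR x) / (10 * x `^ D).
      by field; rewrite gt_eqF // powR_gt0.
    rewrite -expRD (_ : - (x / 2) + x = 2^-1 * x); last by field.
    rewrite ler_pdivlMr ?mulr_gt0 ?powR_gt0 //.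
    by rewrite mulrCA mulrA.
  have e0' := expR_ge0 (- (x / 2)).
  apply: ler_pM => //.
  - by apply: mulr_ge0 => //; lra.
  - by rewrite divr_ge0 ?expR_ge0 // mulr_ge0.
  - by apply: ler_pM => //; lra.
have h6 : expR (- (p ^+ (d * k) * (1 - L%:R * (1 - p) ^+ (k ^ d.-1)) * N%:R)) <= delta / 2.
  apply: (@le_trans _ _ (expR (- ln (2 / delta)))); first by rewrite ler_expR lerN2.
  rewrite expRN lnK ?posrE ?divr_gt0 //.
  by rewrite invf_div.
lra.
Qed.

Lemma critical_lower (eps : R) : 0 < eps -> eps < 1 ->
  evt (fun x => forall m p, x = ln m.+3%:R -> 0 < p -> p < 1 ->
    delta < Pr p (Cn m) -> x `^ (- (D - 1) - eps) <= p).
Proof.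
move=> e0 e1; have D2' := D2; have dl0 := delta0.
(* The union over windows costs [expR (D * x)]; with [s > x] this [l] leaves [expR (- x)], half of
   whose exponent absorbs the mean term [big]. *)
pose l : R := D + 1.
have F1 : evt (fun x : R => 2 * (17 ^+ d * expR l) * x `^ (1 - eps) <= x `^ 1).
  by apply: evt_powR_le; lra.
have F2 := evt_powR_expR 8 1 (@ltr01 R).
have h2 : (0 : R) < 2^-1 by lra.
have F3 := evt_powR_expR (delta^-1) 0 h2.
have := evt_and F1 (evt_and F2 (evt_and F3 (evt_ge 1))).
move=> F; apply: evt_impl F _ => x [{}F1 [{}F2 [{}F3 x1]]] m p xE p0 p1.
have x0 : 0 < x by lra.
have nE : m.+3%:R = expR x by rewrite xE expR_ln_nat.
rewrite powRr1 ?(ltW x0) // in F1; rewrite mul1r powRr1 ?(ltW x0) // in F2.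
rewrite powRr0 mulr1 in F3.
apply: contraTT; rewrite -ltNge -leNgt => pP.
have [s [s0 slo shi]] := nat_above (ltW x0).
have sn : (4 * s <= m.+3)%N by rewrite -(ler_nat R) nE natrM; lra.
have l0 : 0 <= l by rewrite /l; lra.
apply: le_trans (complete_upper p0 p1 d1 s0 sn l0) _.
rewrite natX_expR -xE -expRD.
have big : p * (8 * s)%N.+1%:R ^+ d * (expR l - 1) <= x / 2.
  apply: (@le_trans _ _ (x `^ (- (D - 1) - eps) * (17 * x) ^+ d * expR l)).
    have E1 : 1 <= expR l by have := expR_ge1Dx l; lra.
    apply: ler_pM; [by rewrite mulr_ge0 ?exprn_ge0 // ltW|lra| |lra].
    apply: ler_pM => //; [exact: ltW|exact: exprn_ge0|exact: ltW|].
    rewrite lerXn2r ?nnegrE // ?mulr_ge0 ?(ltW x0) //.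
    by rewrite -addn1 natrD natrM; lra.
  rewrite exprMn -[x ^+ d]powR_mulrn ?(ltW x0) //.
  have -> : x `^ (- (D - 1) - eps) * (17 ^+ d * x `^ D) * expR l =
      17 ^+ d * expR l * (x `^ (- (D - 1) - eps) * x `^ D) by ring.
  rewrite -powRDp // (_ : - (D - 1) - eps + D = 1 - eps); last by ring.
  lra.
apply: (@le_trans _ _ (expR (- (2^-1 * x)))).
  rewrite ler_expR.
  have : l * x <= l * s%:R by rewrite ler_wpM2l // ltW.
  rewrite {1}/l; lra.
rewrite expRN invf_ple ?posrE ?expR_gt0 //.
Qed.

End Critical.

(** * Bounds for the total influence at fixed [eps] *)

Lemma le_of_sqr (R : realType) (a b : R) : 0 <= a -> 0 <= b ->
  a ^+ 2 <= b ^+ 2 -> a <= b.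
Proof. by move=> a0 b0; rewrite ler_pXn2r. Qed.

Local Notation Cn d m := (@complete_occupation d m.+3).
Local Notation total d m p :=
  (m.+3%:R ^+ d * Pr p (pivotal (Cn d m) (0 : {ffun 'I_d -> 'I_m.+3}))).

Lemma powR_half_sqr (R : realType) (x a : R) : (x `^ (a / 2)) ^+ 2 = x `^ a.
Proof. by rewrite -powR_mulrn ?powR_ge0 // -powRrM divfK // pnatr_eq0. Qed.

Lemma powR_exprS (R : realType) (x a : R) k :
  (x `^ a) ^+ k.+1 = x `^ (a * (k%:R + 1)).
Proof. by rewrite -powR_mulrn ?powR_ge0 // -powRrM -natr1. Qed.

Lemma pivotal_ge (R : realType) (d : nat) (delta eps : R) :
  (1 < d)%N -> 0 < delta -> 0 < eps -> eps < 1 ->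
  evt (fun x => forall m p, x = ln m.+3%:R -> 0 < p -> p < 1 ->
    delta < Pr p (Cn d m) -> Pr p (Cn d m) < 1 - delta -> x `^ (d%:R - eps) <= total d m p).
Proof.
move=> d1 dl0 eps0 eps1; have D2' : 2 <= d%:R :> R by rewrite ler_nat.
(* Losses of [x^e] in the density and in [- ln p] leave [x^(d - eps / 2)]; the rest of [eps] absorbs
   the constant. *)
pose e := eps / 4; have e0 : 0 < e by rewrite /e; lra.
have e1 : e < 1 by rewrite /e; lra.
pose C1 := 18 + 8 * d%:R / e.
have C10 : 0 < C1 by rewrite addr_gt0 // divr_gt0 // mulr_gt0 //; lra.
have G1 : evt (fun x : R => 2 * x `^ (e - (d%:R - 1)) <= x `^ 0) by apply: evt_powR_le; lra.
have G2 := evt_powR_expR (4 / delta ^+ 2) (2 * d%:R) (@ltr01 R).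
have G3 : evt (fun x : R => (C1 / delta ^+ 2) * x `^ (d%:R - eps) <= x `^ (d%:R - e - e)).
  by apply: evt_powR_le; rewrite /e; lra.
have U := critical_upper d1 dl0 e0 e1; have L := critical_lower d1 dl0 e0 e1.
have := evt_and G1 (evt_and G2 (evt_and G3 (evt_and U (evt_and L (evt_ge 1))))).
move=> F; apply: evt_impl F _ => x [{}G1 [{}G2 [{}G3 [{}U [{}L x1]]]]] m p xE p0 p1 PC1 PC2.
have x0 : 0 < x by lra.
have nE : m.+3%:R = expR x by rewrite xE expR_ln_nat.
have {}U := U m p xE p0 p1 PC2; have {}L := L m p xE p0 p1 PC1.
rewrite powRr0 in G1; rewrite mul1r in G2.
have ph : p <= 1 / 2 by lra.
set I := total d m p.
have I0 : 0 <= I.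
  by rewrite mulr_ge0 ?exprn_ge0 // PrE Prob_ge0.
(* The contrary assumption bounds [I] from above, which is what makes the quadratic term
   negligible. *)
rewrite leNgt; apply/negP => Ilt.
have n0 : 0 < m.+3%:R :> R by [].
pose I1 := Pr p (pivotal (Cn d m) (0 : {ffun 'I_d -> 'I_m.+3})).
have := @influence_inequality R _ p p0 p1 (Cn d m) I1 m.+3%:R ph n0.
move=> /(_ (fun y => etrans (Prob_piv_shift p y) (esym (PrE p _)))).
rewrite -PrE card_site natrX -xE.
have -> : m.+3%:R ^+ d * (p * (1 - p) * I1) = p * (1 - p) * I by rewrite /I /I1; ring.
have IE : I = m.+3%:R ^+ d * I1 by [].
have q0 : 0 < 1 - p by lra.
have pq1 : p * (1 - p) <= 1 by nra.
have pq0 : 0 < p * (1 - p) by rewrite mulr_gt0.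
have nd0 : 0 < m.+3%:R ^+ d :> R by rewrite exprn_gt0.
(* The summand 1 in [ln k + 1] pays for this term. *)
have second : m.+3%:R * (m.+3%:R ^+ d * (2 * p * (1 - p) * I1) ^+ 2) <= delta ^+ 2.
  have -> : m.+3%:R * (m.+3%:R ^+ d * (2 * p * (1 - p) * I1) ^+ 2) =
     4 * (p * (1 - p)) ^+ 2 * (I ^+ 2) * (m.+3%:R / m.+3%:R ^+ d).
    by rewrite IE; field; rewrite gt_eqF.
  have nn : m.+3%:R / m.+3%:R ^+ d <= (m.+3%:R)^-1 :> R.
    rewrite ler_pdivrMr // mulrC ler_pdivlMr // -expr2 ler_weXn2l // ler1n //.
  have Ix : I ^+ 2 <= x `^ (2 * d%:R).
    have -> : x `^ (2 * d%:R) = (x `^ d%:R) ^+ 2.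
      by rewrite -[RHS]powR_mulrn ?powR_ge0 // -powRrM mulrC.
    rewrite lerXn2r ?nnegrE ?powR_ge0 // ltW //; apply: lt_le_trans Ilt _.
    by rewrite ler_powR //; lra.
  apply: (@le_trans _ _ (4 * x `^ (2 * d%:R) * (m.+3%:R)^-1)).
    apply: ler_pM => //.
    - by rewrite mulr_ge0 ?sqr_ge0 // mulr_ge0 ?sqr_ge0.
    - by rewrite divr_ge0 // ltW.
    - apply: ler_pM => //; [by rewrite mulr_ge0 ?sqr_ge0|exact: sqr_ge0|].
      by rewrite -[leRHS]mulr1 ler_pM2l // expr_le1 // ltW.
  rewrite ler_pdivrMr // nE.
  have := ler_wpM2l (sqr_ge0 delta) G2.
  have -> // : delta ^+ 2 * (4 / delta ^+ 2 * x `^ (2 * d%:R)) = 4 * x `^ (2 * d%:R).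
  by field; rewrite gt_eqF.
have var : delta ^+ 2 * (x + 1) <= Pr p (Cn d m) * (1 - Pr p (Cn d m)) * (x + 1).
  rewrite ler_pM2r; last lra.
  by rewrite expr2 ler_pM //; lra.
move=> main.
have m2 : delta ^+ 2 * x <= log_sobolev_const p * (p * (1 - p) * I) by move: main second var; lra.
have e2 : x `^ e >= 1 by apply: powR_ge1 => //; exact: ltW.
have lp : - ln p <= d%:R * (e^-1 * x `^ e).
  apply: (@le_trans _ _ (d%:R * ln x)); last by rewrite ler_wpM2l // ln_le_powR.
  have : ln (x `^ (- (d%:R - 1) - e)) <= ln p by rewrite ler_ln ?posrE ?powR_gt0.
  rewrite ln_powR; have lx := ln_ge0 x1.
  have : (d%:R - 1 + e) * ln x <= d%:R * ln x by rewrite ler_wpM2r //; lra.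
  lra.
have lscC : log_sobolev_const p <= C1 * x `^ e.
  have -> : C1 * x `^ e = 18 * x `^ e + 8 * (d%:R * (e^-1 * x `^ e)) by rewrite /C1; ring.
  by rewrite /log_sobolev_const; lra.
have lsc0 : 0 <= log_sobolev_const p.
  have : ln p <= 0 by apply: ln_le0; exact: ltW.
  rewrite /log_sobolev_const; lra.
have m3 : delta ^+ 2 * x <= C1 * x `^ e * (x `^ (e - (d%:R - 1)) * I).
  apply: le_trans m2 _; apply: ler_pM => //; first by rewrite mulr_ge0 // ltW.
  rewrite ler_wpM2r //; apply: le_trans U; rewrite ger_pMr //; lra.
have xI : x `^ (d%:R - e - e) <= (C1 / delta ^+ 2) * I.
  have xx : x `^ e * x `^ (e - (d%:R - 1)) * x `^ (d%:R - e - e) = x.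
    rewrite -!powRDp // (_ : e + (e - (d%:R - 1)) + (d%:R - e - e) = 1) ?powRr1 ?(ltW x0) //.
    by ring.
  have pos : 0 < x `^ e * x `^ (e - (d%:R - 1)) by rewrite mulr_gt0 // powR_gt0.
  rewrite -(ler_pM2l pos) xx.
  have -> : x `^ e * x `^ (e - (d%:R - 1)) * (C1 / delta ^+ 2 * I) =
      C1 * x `^ e * (x `^ (e - (d%:R - 1)) * I) / delta ^+ 2 by field; rewrite gt_eqF.
  by rewrite ler_pdivlMr ?exprn_gt0 // mulrC.
have := le_trans G3 xI; rewrite ler_pM2l ?divr_gt0 ?exprn_gt0 //.
by rewrite leNgt Ilt.
Qed.

Lemma pivotal_le (R : realType) (d : nat) (delta eps : R) :
  (1 < d)%N -> 0 < delta -> 0 < eps -> eps < 1 ->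
  evt (fun x => forall m p, x = ln m.+3%:R -> 0 < p -> p < 1 ->
    delta < Pr p (Cn d m) -> Pr p (Cn d m) < 1 - delta ->
    total d m p <= x `^ (d%:R ^+ 2 - 1 + eps)).
Proof.
move=> d1 dl0 eps0 eps1; have D2' : 2 <= d%:R :> R by rewrite ler_nat.
have h2 : (0 : R) < 2^-1 by lra.
have h21 : (2^-1 : R) < 1 by lra.
(* [y = x / p] is at most [x^(d + e)] and the final bound is of order [y^((d + 1) / 2)], so this [e]
   costs [eps / 2] in the exponent. *)
pose e := eps / (d%:R + 1).
have e0 : 0 < e by rewrite divr_gt0 //; lra.
have eE : e * (d%:R + 1) = eps by rewrite /e; field; lra.
have e1 : e < 1 by rewrite ltr_pdivrMr; lra.
(* Vacant segments use up at most [delta / 2] of the probability of incompleteness, so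
   [expR (- (r * N'))] is at least [delta / 2]. *)
pose K := Num.max 0 (ln (2 / delta)).
have K0 : 0 <= K by rewrite le_max lexx.
(* From [h <= 4 d y], which gives [17 h <= 68 d y]. *)
pose M : R := (68 * d%:R) ^+ d.
have M1 : 1 <= M by rewrite exprn_ege1 //; lra.
pose C := 2 * (2 + 33 ^+ d * K * (d%:R + 3)) * M.
have G1 := evt_powR_expR (33 * d%:R) (d%:R + 1) (@ltr01 R).
have G2 := evt_powR_expR M ((d%:R + 1) * d%:R) (@ltr01 R).
have G3 := evt_powR_expR (d%:R * (1 + 2 / delta)) 0 (@ltr01 R).
have G4 : evt (fun x : R => C * x `^ ((d%:R + e) * (d%:R + 1) / 2) <= x `^ (d%:R ^+ 2 - 1 + eps)).
  apply: evt_powR_le; have -> : (d%:R + e) * (d%:R + 1) / 2 = (d%:R * (d%:R + 1) + eps) / 2.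
    by rewrite -eE; ring.
  (* In dimension 2 this product vanishes, and only the surplus [eps / 2] separates the
     exponents. *)
  have : 0 <= (d%:R - 2) * (d%:R + 1) :> R by rewrite mulr_ge0; lra.
  nra.
have G5 : evt (fun x : R => 2 * x `^ (2^-1 - (d%:R - 1)) <= x `^ 0) by apply: evt_powR_le; lra.
have U := critical_upper d1 dl0 h2 h21; have L := critical_lower d1 dl0 e0 e1.
have := evt_and G1 (evt_and G2 (evt_and G3 (evt_and G4 (evt_and G5 (evt_and U (evt_and L (evt_ge 1))))))).
move=> F; apply: evt_impl F _ => x [{}G1 [{}G2 [{}G3 [{}G4 [{}G5 [{}U [{}L x1]]]]]]].
move=> m p xE p0 p1 PC1 PC2.
have x0 : 0 < x by lra.
have nE : m.+3%:R = expR x by rewrite xE expR_ln_nat.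
have {}U := U m p xE p0 p1 PC2; have {}L := L m p xE p0 p1 PC1.
rewrite powRr0 in G5; rewrite mul1r in G1; rewrite mul1r in G2.
rewrite powRr0 mulr1 mul1r in G3.
have ph : p <= 1 / 2 by lra.
have q0 : 0 < 1 - p by lra.
have [y yE] : exists y, y = x / p by exists (x / p).
have y1 : 1 <= y by rewrite yE ler_pdivlMr //; lra.
have yx : y <= x `^ (d%:R + e).
  rewrite yE ler_pdivrMr //.
  apply: (@le_trans _ _ (x `^ (d%:R + e) * x `^ (- (d%:R - 1) - e))); last first.
    by rewrite ler_wpM2l // powR_ge0.
  by rewrite -powRDp // (_ : d%:R + e + (- (d%:R - 1) - e) = 1) ?powRr1 ?(ltW x0) //; ring.
have yx1 : y <= x `^ (d%:R + 1) by apply: le_trans yx _; rewrite ler_powR //; lra.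
have [h [h0 hlo hhi]] : exists h : nat, [/\ (0 < h)%N, 3 * d%:R * y < h%:R & h%:R <= 3 * d%:R * y + 1].
  by apply: nat_above; rewrite mulr_ge0 //; lra.
have hy : h%:R <= 4 * d%:R * y.
  have : 1 <= d%:R * y by rewrite -[leLHS]mulr1 ler_pM //; lra.
  lra.
have Dx : d%:R * y <= d%:R * x `^ (d%:R + 1) by rewrite ler_wpM2l.
have hn : (8 * h < m.+3)%N.
  rewrite -(ltr_nat R) nE natrM; apply: lt_le_trans G1.
  have : 0 < d%:R * x `^ (d%:R + 1) by rewrite mulr_gt0 ?powR_gt0 //; lra.
  lra.
pose Vb := p * (17 * h)%N%:R ^+ d.
have hp3 : 3 * d%:R * x <= p * h%:R.
  have -> : 3 * d%:R * x = p * (3 * d%:R * y) by rewrite yE; field; rewrite gt_eqF.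
  by rewrite ler_wpM2l // ltW.
have h17 : h%:R <= (17 * h)%N%:R ^+ d :> R.
  rewrite -natrX ler_nat; apply: (@leq_trans (17 * h)); first by rewrite leq_pmull.
  by rewrite -[leqLHS]expn1 leq_pexp2l ?muln_gt0 // ltnW.
have xVb : x <= Vb.
  apply: (@le_trans _ _ (p * h%:R)); last by rewrite ler_wpM2l // ltW.
  apply: le_trans hp3; rewrite ler_peMl //; lra.
have Vb0 : 0 < Vb by lra.
have V17 : (17 * h)%N%:R ^+ d <= M * y ^+ d.
  rewrite /M -exprMn lerXn2r ?nnegrE //; last by rewrite natrM; lra.
  by rewrite !mulr_ge0 // (le_trans ler01 y1).
have Vbe : Vb <= expR x.
  apply: (@le_trans _ _ ((17 * h)%N%:R ^+ d)); first by rewrite ger_pMl ?ltW // exprn_gt0 // ltr0n muln_gt0.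
  apply: le_trans V17 _; apply: le_trans G2; rewrite ler_wpM2l // ?(le_trans ler01 M1) //.
  by rewrite powRrM powR_mulrn ?powR_ge0 // lerXn2r ?nnegrE ?powR_ge0 // (le_trans ler01 y1).
pose s := Num.sqrt (x * Vb).
have s2 : s ^+ 2 = x * Vb by rewrite sqr_sqrtr // mulr_ge0 // ltW.
have s0 : 0 < s by rewrite sqrtr_gt0 mulr_gt0.
have xs : x <= s.
  by apply: le_of_sqr; [exact: ltW|exact: ltW|rewrite s2 expr2 ler_pM2l].
have sV : s <= Vb.
  by apply: le_of_sqr; [exact: ltW|exact: ltW|rewrite s2 expr2 ler_pM2r].
(* Since [s^2 = x Vb], one has [2 Vb l^2 = 2 x] and [l a = (d + 3) x]. The exponent [- (d + 1) x]
   pays for [N <= expR (d * x)] and [l^-1 <= expR x]; [l <= 1] because [x <= Vb]. *)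
pose l := x / s; pose a := (d%:R + 3) * s.
have l0 : 0 < l by rewrite divr_gt0.
have l1 : l <= 1 by rewrite ler_pdivrMr // mul1r.
have [N [N' [hN hNN' [r [r0 hr] main]]]] := @pivotal_upper R d m p p0 p1 d1 h a l h0 hn l0 l1.
have tail : (1 - p) ^+ h <= expR (- (3 * d%:R * x)).
  apply: le_trans (exprB_le_expR _ (ltW p0) (ltW p1)) _.
  by rewrite ler_expR lerN2.
have nd0 : 0 <= m.+3%:R ^+ d :> R by rewrite exprn_ge0.
have Dx2 : 2 * x <= d%:R * x by rewrite ler_pM2r.
have dl2 : d%:R * (2 / delta) * expR (- x) <= 1.
  rewrite expRN ler_pdivrMr ?expR_gt0 // mul1r; apply: le_trans G3; move: D2'; clear; lra.
have dl1 : d%:R * expR (- x) <= 1.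
  rewrite expRN ler_pdivrMr ?expR_gt0 // mul1r; apply: le_trans G3.
  have : 0 <= d%:R * (2 / delta) by rewrite mulr_ge0 // divr_ge0 // ltW.
  clear; lra.
have t1 : d%:R * m.+3%:R ^+ d * (1 - p) ^+ h <= delta / 2.
  apply: (@le_trans _ _ (d%:R * expR (- x))); last first.
    have := ler_wpM2l (ltW dl0) dl2; rewrite mulr1.
    have -> : delta * (d%:R * (2 / delta) * expR (- x)) = 2 * (d%:R * expR (- x)).
      by field; rewrite gt_eqF.
    clear; lra.
  rewrite -mulrA ler_wpM2l // natX_expR -xE.
  apply: le_trans (ler_wpM2l (expR_ge0 _) tail) _.
  by rewrite -expRD ler_expR; move: Dx2 x0; clear; lra.
have t2 : m.+3%:R ^+ d * (d%:R * m.+3%:R ^+ d * (1 - p) ^+ h) <= 1.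
  apply: le_trans dl1; rewrite -mulrA mulrCA ler_wpM2l // natX_expR -xE mulrA -expRD.
  apply: le_trans (ler_wpM2l (expR_ge0 _) tail) _.
  by rewrite -expRD ler_expR; move: Dx2 x0; clear; lra.
have rN : r * N'%:R <= K.
  rewrite le_max; apply/orP; right.
  have h' : delta / 2 <= expR (- (r * N'%:R)) by apply: le_trans hr; move: t1 PC2; clear; lra.
  rewrite -ler_expR lnK ?posrE ?divr_gt0 // -[leLHS]invrK -expRN.
  by rewrite -[2 / delta]invf_div lef_pV2 ?posrE ?expR_gt0 ?divr_gt0.
have D30 : 0 <= d%:R + 3 :> R by rewrite addr_ge0.
have a0 : 0 <= a by rewrite mulr_ge0 // ltW.
have NN : N%:R <= N'%:R * 33 ^+ d :> R by rewrite -natrX -natrM ler_nat.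
have m1 : N%:R * (a * r) <= 33 ^+ d * K * (d%:R + 3) * s.
  have -> : N%:R * (a * r) = a * (r * N%:R) by ring.
  have -> : 33 ^+ d * K * (d%:R + 3) * s = a * (K * 33 ^+ d) by rewrite /a; ring.
  rewrite ler_wpM2l //; apply: (@le_trans _ _ (r * (N'%:R * 33 ^+ d))).
    by rewrite ler_wpM2l.
  by rewrite mulrA ler_wpM2r // exprn_ge0.
have m2 : N%:R * (l^-1 * expR (2 * Vb * l ^+ 2 - l * a)) <= 1.
  have -> : 2 * Vb * l ^+ 2 - l * a = - ((d%:R + 1) * x).
    have -> : 2 * Vb * l ^+ 2 = 2 * x.
      by rewrite /l expr_div_n s2; field; rewrite !gt_eqF.
    by rewrite /l /a; field; rewrite gt_eqF.
  have nN : N%:R <= expR (d%:R * x).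
    apply: (@le_trans _ _ ((m.+3 ^ d)%N%:R)); first by rewrite ler_nat.
    by rewrite natrX natX_expR -xE.
  have il : l^-1 <= expR x.
    apply: le_trans Vbe; apply: le_trans sV; rewrite /l invf_div ler_pdivrMr //.
    by rewrite ler_peMr // ltW.
  apply: (@le_trans _ _ (expR (d%:R * x) * (expR x * expR (- ((d%:R + 1) * x))))).
    apply: ler_pM => //; first by rewrite mulr_ge0 ?invr_ge0 ?expR_ge0 // ltW.
    by rewrite ler_wpM2r // expR_ge0.
  by rewrite -!expRD -[leRHS]expR0 ler_expR; clear; lra.
set I := total d m p in main *.
have I0 : 0 <= I by rewrite mulr_ge0 ?exprn_ge0 // PrE Prob_ge0.
have pI : p * I <= 2 * (2 + 33 ^+ d * K * (d%:R + 3)) * s.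
  have c0 : 0 <= 33 ^+ d * K * (d%:R + 3) * s.
    by rewrite !mulr_ge0 ?exprn_ge0 ?(ltW s0).
  have half : p * I <= 2 * (p * (1 - p) * I).
    have : 0 <= p * (1 - 2 * p) * I 
      by apply: mulr_ge0 => //; apply: mulr_ge0; [exact: ltW|move: ph; clear; lra].
    clear; lra.
  rewrite -/Vb mulrDr in main.
  have pqI : p * (1 - p) * I <= 2 + 33 ^+ d * K * (d%:R + 3) * s.
    by move: main t2 m1 m2; clear; lra.
  apply: le_trans half _; rewrite -[leRHS]mulrA ler_pM2l //; apply: le_trans pqI _.
  by rewrite mulrDl lerD2r ler_peMr // (le_trans x1 xs).
pose Z := x `^ ((d%:R + e) * (d%:R + 1) / 2).
have Z0 : 0 <= Z by exact: powR_ge0.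
have sp : s / p <= M * Z.
  have sp0 : 0 <= s / p by rewrite divr_ge0 // ltW.
  apply: le_of_sqr => //; first by rewrite mulr_ge0 // (le_trans ler01 M1).
  have -> : (s / p) ^+ 2 = y * (17 * h)%N%:R ^+ d.
    by rewrite expr_div_n s2 /Vb yE; field; rewrite gt_eqF.
  apply: (@le_trans _ _ (M * y ^+ d.+1)).
    by rewrite exprS mulrCA ler_wpM2l // (le_trans ler01 y1).
  rewrite exprMn; apply: (@le_trans _ _ (M * Z ^+ 2)); last first.
    by rewrite ler_wpM2r ?sqr_ge0 // expr2 ler_peMl // (le_trans ler01 M1).
  rewrite ler_wpM2l // ?(le_trans ler01 M1) //.
  rewrite /Z powR_half_sqr -powR_exprS.
  by rewrite lerXn2r ?nnegrE ?powR_ge0 // (le_trans ler01 y1).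
apply: le_trans G4.
have -> : I = (p * I) / p by field; rewrite gt_eqF.
apply: (@le_trans _ _ (2 * (2 + 33 ^+ d * K * (d%:R + 3)) * (s / p))).
  by rewrite [leRHS]mulrA ler_wpM2r // invr_ge0 ltW.
rewrite /C -[leRHS]mulrA ler_wpM2l //.
by rewrite !mulr_ge0 // addr_ge0 // !mulr_ge0 ?exprn_ge0.
Qed.

Lemma pivotal_bounds (R : realType) (d : nat) (delta eps : R) :
  (1 < d)%N -> 0 < delta -> 0 < eps -> eps < 1 ->
  exists n0 : nat, forall n (p : R) (x : torus d n), (n0 <= n)%N -> 0 < p -> p < 1 ->
    delta < Pr p (@complete_occupation d n) ->
    Pr p (@complete_occupation d n) < 1 - delta ->
    (ln n%:R `^ (d%:R - eps)) / n%:R ^+ d <= Pr p (pivotal (@complete_occupation d n) x) /\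
    Pr p (pivotal (@complete_occupation d n) x)
      <= (ln n%:R `^ (d%:R ^+ 2 - 1 + eps)) / n%:R ^+ d.
Proof.
move=> d1 delta0 eps0 eps1.
have [n0 H] := evt_nat (evt_and (pivotal_ge d1 delta0 eps0 eps1)
                                (pivotal_le d1 delta0 eps0 eps1)).
exists (maxn n0 3) => n p x; rewrite geq_max => /andP[hn n3].
have [m nE] : exists m, n = m.+3 by exists (n - 3)%N; lia.
subst n => p0 p1 PC1 PC2; have [L U] := H _ hn.
have n_gt0 : 0 < m.+3%:R ^+ d :> R by rewrite exprn_gt0.
have -> : Pr p (pivotal (@complete_occupation d m.+3) x) =
    Pr p (pivotal (@complete_occupation d m.+3) (0 : {ffun 'I_d -> 'I_m.+3})).
  by rewrite !PrE; exact: Prob_piv_shift.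
by rewrite ler_pdivrMr // ler_pdivlMr // mulrC; split; [exact: L|exact: U].
Qed.

(* [classical_sets] shadows lemmas of [finset], hence this late import. *)
From mathcomp Require Import classical_sets topology normedtype.
Import numFieldNormedType.Exports.
Local Open Scope classical_set_scope.
Local Open Scope ring_scope.

(** The infimum of the admissible losses at [n] tends to 0, as each fixed loss is admissible from
    some [n] on; adding [1 / (n + 1)] puts [eta n] strictly above it, where monotonicity applies. *)
Lemma vanishing_loss (R : realType) (Q : R -> nat -> Prop) :
  (forall e e' n, (4 <= n)%N -> e <= e' -> Q e n -> Q e' n) ->
  (forall e, 0 < e -> e < 1 -> exists n0, forall n, (n0 <= n)%N -> Q e n) ->
  exists (eta : nat -> R) (n0 : nat), [/\ forall n, 0 <= eta n, eta @ \oo --> (0 : R) &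
    forall n, (n0 <= n)%N -> Q (eta n) n].
Proof.
move=> mono ev.
pose S n : set R := [set e | 0 < e /\ Q e n].
have lbS n : lbound (S n) 0 by move=> e [/ltW].
have hlb n : has_lbound (S n) by exists 0.
pose eta n := inf (S n) + n.+1%:R^-1.
have inf_ge0 n : 0 <= inf (S n).
  (* Where no loss is admissible the infimum is 0 by default; this can happen only below [n1]. *)
  have [->|/set0P[e Se]] := eqVneq (S n) set0; first by rewrite inf0.
  by apply: lb_le_inf => //; exists e.
have le_inf n e : 0 < e -> Q e n -> inf (S n) <= e by move=> e0 Qe; apply: ge_inf.
have half0 : (0 : R) < 1 / 2 by lra.
have half1 : (1 / 2 : R) < 1 by lra.
have [n1 H1] := ev _ half0 half1.
exists eta, (maxn n1 4); split => [n||n].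
- by rewrite addr_ge0 // invr_ge0.
- apply/cvgr0Pnorm_lt => e e0.
  have m0 : 0 < Num.min (e / 2) (1 / 2) by rewrite lt_min half0 andbT; lra.
  have m1 : Num.min (e / 2) (1 / 2) < 1 by rewrite gt_min half1 orbT.
  have [n2 H2] := ev _ m0 m1.
  exists (maxn n2 (Num.truncn (2 / e))) => // n /=; rewrite geq_max => /andP[h2 h3].
  have i1 := le_inf n _ m0 (H2 n h2).
  have i2 : Num.min (e / 2) (1 / 2) <= e / 2 by rewrite ge_min lexx.
  have i3 : n.+1%:R^-1 < e / 2.
    rewrite -[e / 2]invf_div ltf_pV2 ?posrE ?divr_gt0 //.
    by apply: lt_le_trans (truncnS_gt _) _; rewrite ler_nat.
  by rewrite ger0_norm ?addr_ge0 ?invr_ge0 // (splitr e) ler_ltD // (le_trans i1).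
- rewrite geq_max => /andP[h1 h4].
  have Sn : S n !=set0 by exists (1 / 2); split => //; exact: H1.
  have lt : inf (S n) < eta n by rewrite /eta ltrDl invr_gt0.
  have [e [_ Qe] lte] := inf_lt Sn lt.
  by apply: mono Qe => //; exact: ltW.
Qed.

Theorem proposition1p5 (R : realType) (d : nat) (delta : R)
    (hd : (2 <= d)%N) (hdelta : 0 < delta) :
  exists (eta : nat -> R) (n0 : nat),
    [/\ forall n : nat, 0 <= eta n,
        eta @ \oo --> (0 : R)
      & forall (n : nat) (p : R) (x : torus d n),
          (n0 <= n)%N ->
          0 < p -> p < 1 ->
          delta < Pr p (@complete_occupation d n) ->
          Pr p (@complete_occupation d n) < 1 - delta ->
          (ln n%:R `^ (d%:R - eta n)) / n%:R ^+ d
            <= Pr p (pivotal (@complete_occupation d n) x)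
          /\
          Pr p (pivotal (@complete_occupation d n) x)
            <= (ln n%:R `^ (d%:R ^+ 2 - 1 + eta n)) / n%:R ^+ d].
Proof.
(* [p] and [x] are quantified inside [Q], so [eta n] serves all densities and vertices at once. *)
pose Q (e : R) n := forall (p : R) (x : torus d n), 0 < p -> p < 1 ->
  delta < Pr p (@complete_occupation d n) -> Pr p (@complete_occupation d n) < 1 - delta ->
  (ln n%:R `^ (d%:R - e)) / n%:R ^+ d <= Pr p (pivotal (@complete_occupation d n) x) /\
  Pr p (pivotal (@complete_occupation d n) x) <= (ln n%:R `^ (d%:R ^+ 2 - 1 + e)) / n%:R ^+ d.
have mono e e' n : (4 <= n)%N -> e <= e' -> Q e n -> Q e' n.
  move=> n4 ee' H p x p0 p1 h1 h2; have [L U] := H p x p0 p1 h1 h2.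
  have ln1 : 1 <= ln n%:R :> R.
    rewrite -[leLHS]expRK ler_ln ?posrE ?expR_gt0 // ?ltr0n ?(leq_trans _ n4) //.
    (* [expR 1 <= 4] is [expR_le_quad] at 1, hence the threshold 4: from there on [ln n >= 1] and
       powers of it increase with the exponent. *)
    apply: (@le_trans _ _ 4); last by rewrite ler_nat.
    by have := @expR_le_quad R 1 ler01 (lexx 1); rewrite expr1n; lra.
  have ndv : 0 <= (n%:R ^+ d)^-1 :> R by rewrite invr_ge0 exprn_ge0.
  split; [apply: le_trans L|apply: (le_trans U)];
    by rewrite ler_wpM2r // ler_powR //; lra.
have [|eta [n0 [eta0 etac H]]] := vanishing_loss mono.
  move=> e e0 e1; have [n0 H] := pivotal_bounds hd hdelta e0 e1.
  by exists n0 => n hn p x; exact: H.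
by exists eta, n0; split => // n p x hn; exact: H.
Qed.
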